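(* Let $n$ be a nonnegative integer and suppose $bcd=a^2q$ and $ef=aq^{n+1}$. Then \begin{multline*} \sum_{k=0}^n\frac{E(aq^{3k})}{E(a)} \frac{(b,c,d;q^2,p)_k}{(aq/b,aq/c,aq/d;q,p)_k} \frac{(e,f,q^{-n};q,p)_k}{(aq^2/e,aq^2/f,aq^{n+2};q^2,p)_k}\, q^k \\ =\frac{(aq,aq/bc;q,p)_n\,(aq^{1-n}/b,aq^{1-n}/c;q^2,p)_n} {(aq/b,aq/c;q,p)_n\,(aq^{1-n},aq^{1-n}/bc;q^2,p)_n} \,{_{10}\omega_9}(a^2/ef;b,c,d,a/e,a/f,q^{1-n},q^{-n};q^2,p). \end{multline*}
   Context: Let $p$ be a complex number with $|p|<1$, $q$ a nonzero complex number, and all parameters generic so that no denominator vanishes. For nonzero $x$, $E(x)=E(x;p)=\prod_{k\ge 0}(1-xp^k)(1-p^{k+1}/x)$. For a nonzero base $Q$ and integer $m$, $(a;Q,p)_m=\prod_{k=0}^{m-1}E(aQ^k)$ if $m>0$, $=1$ if $m=0$, and $=1/\prod_{k=0}^{-m-1}E(aQ^{m+k})$ if $m<0$; $(a_1,\dots,a_s;Q,p)_m=\prod_{i=1}^s(a_i;Q,p)_m$. For parameters with $(a_4\cdots a_{r+1})^2=a_1^{r-3}Q^{r-5}$ and one of $a_4,\dots,a_{r+1}$ of the form $Q^{-N}$ ($N$ a nonnegative integer), \[{_{r+1}\omega_r}(a_1;a_4,\dots,a_{r+1};Q,p)=\sum_{k\ge 0}\frac{E(a_1Q^{2k})}{E(a_1)}\frac{(a_1,a_4,\dots,a_{r+1};Q,p)_k\,Q^k}{(Q,a_1Q/a_4,\dots,a_1Q/a_{r+1};Q,p)_k}.\]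 (In the ${_{10}\omega_9}$ above, whichever of $q^{1-n},q^{-n}$ is an integer power $q^{-2N}$ of the base $q^2$ makes the series terminate.) *)

(* Defs.v *)
From HB Require Import structures.
From mathcomp Require Import all_boot all_order all_algebra.
From mathcomp Require Import complex.
Import ComplexField.
From mathcomp Require Import all_classical all_reals topology normedtype sequences.
Set Implicit Arguments. Unset Strict Implicit. Unset Printing Implicit Defensive.
Import Order.TTheory GRing.Theory Num.Theory.
Import numFieldNormedType.Exports.
Local Open Scope ring_scope.
Local Open Scope complex_scope.
Local Open Scope classical_set_scope.

Section Elliptic.
Variable R : realType.
Local Notation C := R[i].

Definition theta_partial (p x : C) (n : nat) : C :=
  \prod_(k < n) ((1 - x * p ^+ k) * (1 - p ^+ k.+1 / x)).

Definition Eth (p x : C) : C :=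
  lim ((theta_partial p x : nat -> C^o) @ \oo).

Definition epoch (p Q a : C) (m : nat) : C := \prod_(k < m) Eth p (a * Q ^+ k).

Definition epochs (p Q : C) (s : seq C) (m : nat) : C :=
  \prod_(a <- s) epoch p Q a m.

(* The terminating very-well-poised series _{r+1}omega_r(a1; a4,...,a_{r+1}; Q, p),
   where one of the a_i equals Q^{-N}; the series is summed over 0 <= k <= N
   (all later terms contain the factor E(1) = 0). *)
Definition omega (p Q a1 : C) (s : seq C) (N : nat) : C :=
  \sum_(k < N.+1)
    (Eth p (a1 * Q ^+ (2 * k)) / Eth p a1) *
    (epochs p Q (a1 :: s) k * Q ^+ k) /
    epochs p Q (Q :: [seq a1 * Q / ai | ai <- s]) k.

End Elliptic.

(* Main.v *)
Require Import Defs.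
From HB Require Import structures.
From mathcomp Require Import all_boot all_order all_algebra.
From mathcomp Require Import complex.
From mathcomp Require Import all_classical all_reals topology normedtype sequences.
From mathcomp Require Import lebesgue_measure exp.
From mathcomp Require Import ring lra zify.
Set Implicit Arguments. Unset Strict Implicit. Unset Printing Implicit Defensive.
Import Order.TTheory GRing.Theory Num.Theory.
Local Open Scope ring_scope.

(** Write [E (X^2) = X h(X)] with [h(1/X) = - h(X)]; in the balanced
    series at hand all monomial factors cancel, so the identity becomes one about [h], with
    arguments in an additive group.  The only property of [h] needed is
    that [F(x,y) = h(x-y) h(x+y-s)] satisfies the Pluecker relation.  This holds because, by the
    Jacobi triple product, [y E(xy) E(x/y)] is of the form [f(x) g(y) - g(x) f(y)].

    A linear combination of products of [n] factors [F(x_i,e)] that vanishes at [n+1] points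
    vanishes identically.  With denominators cleared, both sides of the transformation are of
    this kind as functions of [e], where [ef] is fixed.  At the points [e = a q^(2i)] the
    left-hand side starts at [k = i] and is a shifted instance of the case [f = a], while the
    right-hand side reduces to the single term [j = i].  So everything follows from the
    summation which is the case [f = a].  That summation is obtained, by induction on [n], in
    the same way in the variable [d] (with [bd] fixed), from the points [d = 1] and
    [d = a q^s], [1 <= s <= n]: at the latter, the sum is a shifted shorter one with [d = a],
    and the case [d = a] follows again by interpolation in [e].

    Interpolation needs [q], [a], [c] generic; the general case is a limit, as [E] is continuous. *)

(** * Finite products of an odd function *)

(** Since E (X^2) = X h(X), the function h needs a square root of every argument, chosen
    multiplicatively. This is why arguments are formal elements of G, sent to complex numbers by a
    character only at the end. G is a commutative ring so that integer multiples are products and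
    arguments can be compared by [ring].

    Interpolation in e keeps e + f = s fixed. The factor F(x,e) is invariant under the exchange of e
    and s - e, so that h(u-e) h(u-f) is a single factor; this is what brings both sides down to
    degree n, where n + 1 nodes suffice.

    The two interpolations lean on each other without a circle. In the variable d, length n calls
    for the case d = a at lengths smaller than n only; in the variable e, the case d = a at a length
    r calls for the summation at lengths at most r. A strong induction on n therefore closes. *)

Section OddFunction.
Variables (G : comNzRingType) (K : fieldType) (h : G -> K).
Hypothesis h_odd : forall x, h (- x) = - h x.

(** The elliptic shifted factorial with its monomial factor removed; [epochE] restores that
    factor. *)
Definition ph (x Q : G) (k : nat) : K := \prod_(i < k) h (x + i%:R * Q).

Lemma ph0 x Q : ph x Q 0 = 1.
Proof. by rewrite /ph big_ord0. Qed.

Lemma phS x Q k : ph x Q k.+1 = ph x Q k * h (x + k%:R * Q).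
Proof. by rewrite /ph big_ord_recr. Qed.

Lemma ph1 x Q : ph x Q 1 = h x.
Proof. by rewrite phS ph0 mul1r mul0r addr0. Qed.

(** The argument [y] is tied by an equation instead of being written out, so that each use chooses
    its form and leaves the comparison to [ring]. *)
Lemma phD y x Q m n : y = x + m%:R * Q -> ph x Q (m + n) = ph x Q m * ph y Q n.
Proof.
move=> ->; elim: n => [|n IH]; first by rewrite addn0 ph0 mulr1.
rewrite addnS !phS IH -mulrA; congr (_ * (_ * h _)); ring.
Qed.

Lemma phSl y x Q n : y = x + Q -> ph x Q n.+1 = h x * ph y Q n.
Proof. by move=> ->; rewrite -(add1n n) (@phD (x + Q)) ?ph1 // mul1r. Qed.

(* Reversal of the product; the hypothesis says that [y] is minus the last argument of [ph x Q m]. *)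
Lemma ph_rev y x Q m : x + y + m%:R * Q = Q -> ph x Q m = (-1) ^+ m * ph y Q m.
Proof.
elim: m x y => [|m IH] x y e; first by rewrite !ph0 mulr1.
have ey : y = Q - x - m.+1%:R * Q by rewrite -[X in X - x - _]e; ring.
rewrite (@phSl (x + Q)) // (IH (x + Q) y); last by rewrite ey; ring.
rewrite phS exprS; have -> : y + m%:R * Q = - x by rewrite ey; ring.
rewrite h_odd; ring.
Qed.

(** Even and odd indices of a base [q] product give one base [q2] product each. Passing between the
    two bases of the identity rests on this splitting. *)
Lemma ph_double q2 y x q m : q2 = q + q -> y = x + q ->
  ph x q m.*2 = ph x q2 m * ph y q2 m.
Proof.
move=> -> ->; elim: m => [|m IH]; first by rewrite !ph0 mulr1.
rewrite doubleS !phS IH -addnn.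
have -> : x + (m + m)%:R * q = x + m%:R * (q + q) by ring.
have -> : x + (m + m).+1%:R * q = x + q + m%:R * (q + q) by ring.
ring.
Qed.

Lemma ph_doubleS q2 y x q m : q2 = q + q -> y = x + q ->
  ph x q m.*2.+1 = ph x q2 m.+1 * ph y q2 m.
Proof.
move=> e1 e2; rewrite phS (ph_double _ e1 e2) phS mulrAC; congr (_ * h _ * _).
by rewrite e1 -addnn; ring.
Qed.

Hypothesis h00 : h 0 = 0.
Lemma ph_eq0 (i : nat) x Q m : (i < m)%N -> x + i%:R * Q = 0 -> ph x Q m = 0.
Proof.
move=> im e; apply/eqP; rewrite prodf_seq_eq0; apply/hasP; exists (Ordinal im).
  by rewrite mem_index_enum.
by rewrite /= e h00.
Qed.

Lemma ph_neq0 x Q m : (forall i, (i < m)%N -> h (x + i%:R * Q) != 0) -> ph x Q m != 0.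
Proof. by move=> H; apply/prodf_neq0 => i _; apply: H. Qed.

End OddFunction.

(** * Interpolation *)

Section Interpolation.
Variables (G : zmodType) (K : fieldType) (F : G -> G -> K).
Hypothesis F_plucker : forall x y u v,
  F x y * F u v = F x u * F y v - F x v * F y u.
Hypothesis Fxx : forall x, F x x = 0.
Hypothesis F_anti : forall x y, F x y = - F y x.

(** The span of the products of [n] factors [F x_i], as functions of the second argument. Zero is
    put into every degree because constants enter only in degree 0. *)
Inductive theta_deg : nat -> (G -> K) -> Prop :=
| theta_cst c : theta_deg 0 (fun=> c)
| theta_zero n : theta_deg n (fun=> 0)
| theta_mulF n x f : theta_deg n f -> theta_deg n.+1 (fun e => F x e * f e)
| theta_add n f g : theta_deg n f -> theta_deg n g -> theta_deg n (fun e => f e + g e)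
| theta_ext n f g : theta_deg n f -> f =1 g -> theta_deg n g.

Lemma theta_scale n f c : theta_deg n f -> theta_deg n (fun e => c * f e).
Proof.
elim => [k|m|m x g _ IH|m g1 g2 _ IH1 _ IH2|m g1 g2 _ IH e12].
- exact: (theta_cst (c * k)).
- by apply: (theta_ext (theta_zero m)) => e; rewrite mulr0.
- by apply: (theta_ext (theta_mulF x IH)) => e; rewrite mulrCA.
- by apply: (theta_ext (theta_add IH1 IH2)) => e; rewrite mulrDr.
- by apply: (theta_ext IH) => e; rewrite e12.
Qed.

Lemma theta_mul m n f g : theta_deg m f -> theta_deg n g ->
  theta_deg (m + n) (fun e => f e * g e).
Proof.
move=> tf tg; elim: tf => [k|{}m|{}m x {}f _ IH|{}m f1 f2 _ IH1 _ IH2|{}m f1 f2 _ IH e12].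
- exact: theta_scale.
- by apply: (theta_ext (theta_zero _)) => e; rewrite mul0r.
- by rewrite addSn; apply: (theta_ext (theta_mulF x IH)) => e; rewrite mulrA.
- by apply: (theta_ext (theta_add IH1 IH2)) => e; rewrite mulrDl.
- by apply: (theta_ext IH) => e; rewrite e12.
Qed.

Lemma theta_sub n f g : theta_deg n f -> theta_deg n g -> theta_deg n (fun e => f e - g e).
Proof.
move=> tf tg; apply: (theta_ext (theta_add tf (theta_scale (-1) tg))) => e.
by rewrite mulN1r.
Qed.

Lemma theta_sum (I : Type) (r : seq I) (P : pred I) n (f : I -> G -> K) :
  (forall i, P i -> theta_deg n (f i)) -> theta_deg n (fun e => \sum_(i <- r | P i) f i e).
Proof.
move=> H; elim: r => [|i r IH].
  by apply: (theta_ext (theta_zero n)) => e; rewrite big_nil.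
case Pi: (P i); last by apply: (theta_ext IH) => e; rewrite big_cons Pi.
by apply: (theta_ext (theta_add (H i Pi) IH)) => e; rewrite big_cons Pi.
Qed.

Lemma theta_deg0 f e : theta_deg 0 f -> f e = f 0.
Proof.
move En: 0%N => n tf; elim: tf En => //.
- by move=> m f1 f2 _ IH1 _ IH2 Em; rewrite IH1 // IH2.
- by move=> m f1 f2 _ IH1 fg Em; rewrite -!fg IH1.
Qed.

(** By the Pluecker relation every [F x] is a combination of [F z] and [F v], so [f] is a binary
    form in these two. The coefficient of the pure power of [F v] is [k], up to sign, and all other
    terms are divisible by [F e z]. *)
Lemma theta_split n f z v : F z v != 0 -> theta_deg n.+1 f ->
  exists g k, theta_deg n g /\ forall e, f e = F e z * g e + k * F e v ^+ n.+1.
Proof.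
move=> zv; move En: n.+1 => n1 tf; elim: tf n En => {n1 f}.
- by [].
- move=> n m _; exists (fun=> 0), 0; split; first exact: theta_zero.
  by move=> e; rewrite mulr0 mul0r addr0.
- move=> n x f tf IH m [emn]; subst m.
  pose al := F x v / F z v; pose be := - F x z / F z v.
  have Fx e : F x e = - al * F e z - be * F e v.
    have := F_plucker x e z v => H.
    by apply: (mulIf zv); rewrite H /al /be; field.
  (* The induction hypothesis speaks of positive degrees only; in degree 0 the cofactor [f] is
     constant. *)
  case: n tf IH => [|n] tf IH.
    exists (fun e => - al * f e), (- be * f 0); split; first exact: theta_scale.
    by move=> e; rewrite Fx (theta_deg0 e tf); ring.
  have [g [k [tg fE]]] := IH n erefl.
  exists (fun e => F x e * g e + (- al * k) * F e v ^+ n.+1), (- be * k); split; last first.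
    by move=> e; rewrite fE Fx [_ ^+ n.+2]exprS; ring.
  apply: theta_add; first exact: theta_mulF.
  apply: theta_scale; elim: {tg fE IH tf}n.+1 => [|j IH]; first exact: (theta_cst 1).
  apply: (theta_ext (theta_scale (-1) (theta_mulF v IH))) => e.
  rewrite (F_anti e).
  by rewrite [in RHS]exprS; ring.
- move=> n f1 f2 _ IH1 _ IH2 m En; have [g1 [k1 [t1 E1]]] := IH1 m En.
  have [g2 [k2 [t2 E2]]] := IH2 m En.
  exists (fun e => g1 e + g2 e), (k1 + k2); split; first exact: theta_add.
  by move=> e; rewrite E1 E2; ring.
- move=> n f1 f2 _ IH e12 m En; have [g [k [t E]]] := IH m En.
  by exists g, k; split=> // e; rewrite -e12.
Qed.

(** Split at the last two nodes. At [z n.+1] only the pure power survives, so its coefficient is 0;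
    the cofactor of [F e (z n.+1)] has one degree less and vanishes at the remaining nodes. *)
Lemma theta_interp0 n f (z : nat -> G) : theta_deg n f ->
  (forall i j, (i <= n)%N -> (j < i)%N -> F (z i) (z j) != 0) ->
  (forall i, (i <= n)%N -> f (z i) = 0) -> forall e, f e = 0.
Proof.
elim: n f z => [|n IH] f z tf zz fz e.
  by rewrite (theta_deg0 e tf) -(theta_deg0 (z 0%N) tf) fz.
have zv : F (z n.+1) (z n) != 0 by apply: zz.
have [g [k [tg fE]]] := theta_split zv tf.
have k0 : k = 0.
  have := fz n.+1 (leqnn _); rewrite fE Fxx mul0r add0r => /eqP.
  by rewrite mulf_eq0 expf_eq0 (negbTE zv) /= orbF => /eqP.
rewrite fE k0 mul0r addr0 (IH g z) ?mulr0 //.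
- by move=> i j ile ji; apply: zz => //; apply: leqW.
- move=> i ile; have := fz i (leqW ile); rewrite fE k0 mul0r addr0 => /eqP.
  rewrite mulf_eq0 => /orP [|/eqP //] /eqP H.
  have F2 : F (z n.+1) (z i) != 0 by apply: zz.
  by move: F2; rewrite F_anti H oppr0 eqxx.
Qed.

Lemma theta_interp n f g (z : nat -> G) : theta_deg n f -> theta_deg n g ->
  (forall i j, (i <= n)%N -> (j < i)%N -> F (z i) (z j) != 0) ->
  (forall i, (i <= n)%N -> f (z i) = g (z i)) -> f =1 g.
Proof.
move=> tf tg zz fg e; apply/eqP; rewrite -subr_eq0; apply/eqP.
apply: (theta_interp0 (theta_sub tf tg) zz) => i ile.
by rewrite fg // subrr.
Qed.

End Interpolation.

(** * The transformation for odd functions satisfying the Pluecker relation *)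

Section Quadratic.
Variables (G : comNzRingType) (K : fieldType) (h : G -> K) (q : G).
Local Notation F s := (fun x y => h (x - y) * h (x + y - s)).
Hypothesis h_odd : forall x, h (- x) = - h x.
Hypothesis h00 : h 0 = 0.
Hypothesis h_plucker : forall s x y u v,
  F s x y * F s u v = F s x u * F s y v - F s x v * F s y u.
Hypothesis hq : forall i j : nat, i != j -> h (i%:R * q - j%:R * q) != 0.

Local Notation ph := (ph h).
Local Notation q2 := (q + q).

Lemma F_diag s x : F s x x = 0.
Proof. by rewrite /= subrr h00 mul0r. Qed.

Lemma F_anti s x y : F s x y = - F s y x.
Proof. by rewrite /= -(opprB y x) h_odd mulNr (addrC x). Qed.

Lemma theta_ph_sub s u Q k : theta_deg (F s) k (fun e => ph (u - e) Q k * ph (u - (s - e)) Q k).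
Proof.
elim: k => [|k IH].
  by apply: (theta_ext (theta_cst _ 1)) => e; rewrite !ph0 mulr1.
apply: (theta_ext (theta_mulF (u + k%:R * Q) IH)) => e; rewrite !phS.
have -> : u - e + k%:R * Q = u + k%:R * Q - e by ring.
have -> : u - (s - e) + k%:R * Q = u + k%:R * Q + e - s by ring.
ring.
Qed.

Lemma theta_ph s Q k : theta_deg (F s) k (fun e => ph e Q k * ph (s - e) Q k).
Proof.
elim: k => [|k IH].
  by apply: (theta_ext (theta_cst _ 1)) => e; rewrite !ph0 mulr1.
apply: (theta_ext (theta_mulF (- (k%:R * Q)) IH)) => e; rewrite !phS.
have -> : - (k%:R * Q) - e = - (e + k%:R * Q) by ring.
have -> : - (k%:R * Q) + e - s = - (s - e + k%:R * Q) by ring.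
rewrite !h_odd; ring.
Qed.

(* [lsum] is the left-hand side multiplied by its denominators up to [k = n], in additive
   notation: [b + c + d = 2a + q] and [e + f = a + (n + 1) q]. *)
Definition xfac a n k x : K := ph x q2 k * ph (a + (1 + k)%:R * q - x) q (n - k).
Definition yfac a n k y : K := ph y q k * ph (a + (2 + 2 * k)%:R * q - y) q2 (n - k).
Definition lsum n a b c d e f : K := \sum_(k < n.+1)
  h (a + (3 * k)%:R * q) * ph (- (n%:R * q)) q k * ph (a + (n + 2 + 2 * k)%:R * q) q2 (n - k) *
  (xfac a n k b * xfac a n k c * xfac a n k d) * (yfac a n k e * yfac a n k f).

Lemma theta_xfac s a n k : (k <= n)%N ->
  theta_deg (F s) n (fun d => xfac a n k (s - d) * xfac a n k d).
Proof.
move=> kn; have := theta_mul (theta_ph s q2 k) (theta_ph_sub s (a + (1 + k)%:R * q) q (n - k)).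
rewrite subnKC // => /theta_ext; apply => d; rewrite /xfac; ring.
Qed.

Lemma theta_yfac s a n k : (k <= n)%N ->
  theta_deg (F s) n (fun e => yfac a n k e * yfac a n k (s - e)).
Proof.
move=> kn; have := theta_mul (theta_ph s q k) (theta_ph_sub s (a + (2 + 2 * k)%:R * q) q2 (n - k)).
rewrite subnKC // => /theta_ext; apply => e; rewrite /yfac; ring.
Qed.

Lemma theta_lsum_e s n a b c d : theta_deg (F s) n (fun e => lsum n a b c d e (s - e)).
Proof.
apply: theta_sum => k _; apply: theta_scale; apply: theta_yfac; exact: leq_ord.
Qed.

Lemma theta_lsum_d s n a c e f : theta_deg (F s) n (fun d => lsum n a (s - d) c d e f).
Proof.
apply: theta_sum => k _.
have := theta_scale (h (a + (3 * k)%:R * q) * ph (- (n%:R * q)) q k *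
   ph (a + (n + 2 + 2 * k)%:R * q) q2 (n - k) * xfac a n k c * (yfac a n k e * yfac a n k f))
   (@theta_xfac s a n k (leq_ord k)).
move=> /theta_ext; apply => d; ring.
Qed.

(** Starting the sum at k = i moves [a] by 3i steps, the base [q2] parameters b, c, d by 2i and the
    base [q] parameters e, f by i. With n replaced by n - i, both balancing conditions survive. *)
Lemma xfac_shift a i m l x : (l <= m)%N -> xfac a (i + m) (i + l) x =
  ph x q2 i * xfac (a + (3 * i)%:R * q) m l (x + (2 * i)%:R * q).
Proof.
move=> lm; rewrite /xfac subnDl (@phD _ _ _ (x + (2 * i)%:R * q)); last by ring.
rewrite -mulrA; congr (_ * (_ * ph _ _ _)); ring.
Qed.

Lemma yfac_shift a i m l y : (l <= m)%N -> yfac a (i + m) (i + l) y =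
  ph y q i * yfac (a + (3 * i)%:R * q) m l (y + i%:R * q).
Proof.
move=> lm; rewrite /yfac subnDl (@phD _ _ _ (y + i%:R * q)); last by ring.
rewrite -mulrA; congr (_ * (_ * ph _ _ _)); ring.
Qed.

Lemma sum_drop i m (t : nat -> K) : (forall k, (k < i)%N -> t k = 0) ->
  \sum_(k < (i + m).+1) t k = \sum_(l < m.+1) t (i + l)%N.
Proof.
move=> t0; rewrite -addnS big_split_ord /= big1 ?add0r // => k _; exact: t0.
Qed.

(** The two alternatives serve the two interpolations: the factor of d kills the first terms at the
    nodes in d, and the factor of e does so at the nodes in e. *)
Lemma lsum_shift n i m a b c d e f : n = (i + m)%N ->
  (forall k, (k < i)%N -> xfac a n k d = 0 \/ yfac a n k e = 0) ->
  lsum n a b c d e f =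
  ph (- (n%:R * q)) q i * (ph b q2 i * ph c q2 i * ph d q2 i) * (ph e q i * ph f q i) *
  lsum m (a + (3 * i)%:R * q) (b + (2 * i)%:R * q) (c + (2 * i)%:R * q) (d + (2 * i)%:R * q)
       (e + i%:R * q) (f + i%:R * q).
Proof.
move=> -> van; rewrite /lsum (@sum_drop i m (fun k =>
  h (a + (3 * k)%:R * q) * ph (- ((i + m)%:R * q)) q k *
  ph (a + (i + m + 2 + 2 * k)%:R * q) q2 (i + m - k) *
  (xfac a (i + m) k b * xfac a (i + m) k c * xfac a (i + m) k d) *
  (yfac a (i + m) k e * yfac a (i + m) k f))); last first.
  by move=> k /van [->|->]; rewrite ?(mulr0, mul0r).
rewrite big_distrr /=; apply: eq_bigr => l _; have lm := leq_ord l.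
rewrite !xfac_shift // !yfac_shift // subnDl.
rewrite (@phD _ _ _ (- (m%:R * q)) (- ((i + m)%:R * q)) q i l); last by ring.
have -> : a + (3 * (i + l))%:R * q = a + (3 * i)%:R * q + (3 * l)%:R * q by ring.
have -> : a + (i + m + 2 + 2 * (i + l))%:R * q =
  a + (3 * i)%:R * q + (m + 2 + 2 * l)%:R * q by ring.
ring.
Qed.

(** The zero comes from the cleared denominator: the second product runs through [h 0]. *)
Lemma xfac_eq0 a n s k : (k < s <= n)%N -> xfac a n k (a + s%:R * q) = 0.
Proof.
move=> /andP [ks sn]; have lt : (s - k.+1 < n - k)%N by lia.
rewrite /xfac [X in _ * X](ph_eq0 h00 lt) ?mulr0 // natrB //; ring.
Qed.

Lemma yfac_eq0 a n i k : (k < i <= n)%N -> yfac a n k (a + (2 * i)%:R * q) = 0.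
Proof.
move=> /andP [ki i_n]; have lt : (i - k.+1 < n - k)%N by lia.
rewrite /yfac [X in _ * X](ph_eq0 h00 lt) ?mulr0 // natrB //; ring.
Qed.

(** * The summation that is the case [f = a] *)

Definition gen a := forall i j : nat, h (a + i%:R * q - j%:R * q) != 0.

(** The closed form of the summation, with denominators cleared as in [lsum]. For d = a + s q with 1
    <= s <= n its last product contains [h 0] when n - s is odd, in agreement with [lsum_B_odd]. *)
Definition Aprod n a b c d : K :=
  ph a q n.+1 * ph (a + (n + 2)%:R * q) q2 n * ph q2 q2 n *
  (ph (a + q - n%:R * q - b) q2 n * ph (a + q - n%:R * q - c) q2 n *
   ph (a + q - n%:R * q - d) q2 n).

(* The case [f = a]. *)
Definition Aprop n := forall a b c d, gen a -> gen c -> gen (c - a) ->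
  b + c + d = a + a + q -> lsum n a b c d a ((n + 1)%:R * q) = Aprod n a b c d.

Lemma gen_shift a b i : gen a -> b = a + i%:R * q -> gen b.
Proof. by move=> ga -> j k; have := ga (i + j)%N k; congr (h _ != 0); ring. Qed.

Lemma gen_shiftN a b i : gen a -> b = a - i%:R * q -> gen b.
Proof. by move=> ga -> j k; have := ga j (i + k)%N; congr (h _ != 0); ring. Qed.

(** The node is chosen so that the shift by i sends e to a + 3i q, which is the new a; what remains
    is then an instance of the summation, of length m. *)
Lemma lsum_node i m a b c d : Aprop m -> gen a -> gen c -> gen (c - a) ->
  b + c + d = a + a + q ->
  lsum (i + m) a b c d (a + (2 * i)%:R * q) ((m + 1)%:R * q - i%:R * q) =
  ph (- ((i + m)%:R * q)) q i * ph ((m + 1)%:R * q - i%:R * q) q i *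
  ph (a + (2 * i)%:R * q) q (i + m).+1 * ph (a + (3 * i + m + 2)%:R * q) q2 m * ph q2 q2 m *
  ((ph b q2 i * ph (a + (1 + i)%:R * q - m%:R * q - b) q2 m) *
   (ph c q2 i * ph (a + (1 + i)%:R * q - m%:R * q - c) q2 m) *
   (ph d q2 i * ph (a + (1 + i)%:R * q - m%:R * q - d) q2 m)).
Proof.
move=> Am ga gc gca E; rewrite (@lsum_shift _ i m) //; last first.
  by move=> k ki; right; apply: yfac_eq0; rewrite ki leq_addr.
have -> : a + (2 * i)%:R * q + i%:R * q = a + (3 * i)%:R * q by ring.
rewrite (subrK (i%:R * q)) Am; first last.
- have -> : b = a + a + q - c - d by rewrite -E; ring.
  ring.
- by apply: (gen_shiftN (i := i) gca); ring.
- exact: (gen_shift (i := (2 * i)%N) gc).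
- exact: (gen_shift (i := (3 * i)%N) ga).
rewrite /Aprod -addnS (@phD _ _ _ (a + (3 * i)%:R * q) _ q i m.+1); last by ring.
have -> : a + (3 * i)%:R * q + (m + 2)%:R * q = a + (3 * i + m + 2)%:R * q by ring.
have e x : a + (3 * i)%:R * q + q - m%:R * q - (x + (2 * i)%:R * q) =
  a + (1 + i)%:R * q - m%:R * q - x by ring.
rewrite !e; ring.
Qed.

Lemma gen_node a n i j : (j < i)%N -> gen a ->
  F (a + (n + 1)%:R * q) (a + (2 * i)%:R * q) (a + (2 * j)%:R * q) != 0.
Proof.
move=> ji ga; rewrite mulf_neq0 //.
  have := @hq (2 * i) (2 * j); have -> : (2 * i != 2 * j)%N by lia.
  by move=> /(_ isT); congr (h _ != 0); ring.
by have := ga (2 * i + 2 * j)%N (n + 1)%N; congr (h _ != 0); ring.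
Qed.


(* The value in the case [d = a], [n = 2r]; it is 0 for odd [n]. *)
Definition Bprod r a b c e f : K :=
  ph a q2 (3 * r).+1 * ph q q r.*2 * ph q q2 r * ph b q2 r * ph c q2 r *
  (ph (b + q - e) q2 r * ph (b + q - f) q2 r *
   (ph (a + (2 + 2 * r)%:R * q - e) q2 r * ph (a + (2 + 2 * r)%:R * q - f) q2 r)).

Lemma theta_Bprod s r a b c : theta_deg (F s) r.*2 (fun e => Bprod r a b c e (s - e)).
Proof.
apply: theta_scale; rewrite -addnn.
by apply: theta_mul; apply: theta_ph_sub.
Qed.

(** The node i in the half i <= r, with r = i + t; the shifted sum has length 2r - i = i + 2t. Both
    sides are cut into the same runs of arguments, and reversing some of them gives the sign
    (-1)^(i+t) on each side. *)
Lemma Bprod_node i t a b c : b + c = a + q ->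
  ph (- ((i + (i + t.*2))%:R * q)) q i * ph ((i + t.*2 + 1)%:R * q - i%:R * q) q i *
  ph (a + (2 * i)%:R * q) q (i + (i + t.*2)).+1 *
  ph (a + (3 * i + (i + t.*2) + 2)%:R * q) q2 (i + t.*2) * ph q2 q2 (i + t.*2) *
  ((ph b q2 i * ph (a + (1 + i)%:R * q - (i + t.*2)%:R * q - b) q2 (i + t.*2)) *
   (ph c q2 i * ph (a + (1 + i)%:R * q - (i + t.*2)%:R * q - c) q2 (i + t.*2)) *
   (ph a q2 i * ph (a + (1 + i)%:R * q - (i + t.*2)%:R * q - a) q2 (i + t.*2))) =
  Bprod (i + t) a b c (a + (2 * i)%:R * q) ((i + t.*2 + 1)%:R * q - i%:R * q).
Proof.
move=> E; have eb : b = a + q - c by rewrite -E; ring.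
have ec : a = b + c - q by rewrite E; ring.
rewrite /Bprod -!addnn.
rewrite (@ph_rev _ _ _ h_odd ((t + t + i + 1)%:R * q) (- _)); last by ring.
have -> : (i + (t + t) + 1)%:R * q - i%:R * q = (t + t + 1)%:R * q by ring.
rewrite (_ : (i + (i + (t + t))).+1 = (i + t).*2.+1); last by lia.
rewrite (@ph_doubleS _ _ _ q2 (a + (2 * i + 1)%:R * q)); [|by [] | by ring].
have -> : a + (3 * i + (i + (t + t)) + 2)%:R * q = a + (4 * i + 2 * t + 2)%:R * q by ring.
have -> : (i + (t + t) = t + (i + t))%N by lia.
rewrite [ph q2 q2 _](@phD _ _ _ ((2 + 2 * t)%:R * q)); last by ring.
rewrite [ph (a + _ - _ - b) _ _](_ : _ = ph (c - (2 * t)%:R * q) q2 (i + t) *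
    ph (c + (2 * i)%:R * q) q2 t); last first.
  rewrite (addnC t (i + t)%N) (@phD _ _ _ (c + (2 * i)%:R * q)); last by rewrite eb; ring.
  by congr (ph _ _ _ * _); rewrite eb; ring.
rewrite [ph (a + _ - _ - c) _ _](_ : _ = ph (b - (2 * t)%:R * q) q2 (i + t) *
    ph (b + (2 * i)%:R * q) q2 t); last first.
  rewrite (addnC t (i + t)%N) (@phD _ _ _ (b + (2 * i)%:R * q)); last by rewrite eb; ring.
  by congr (ph _ _ _ * _); rewrite eb; ring.
rewrite [ph (a + _ - _ - a) _ _](@phD _ _ _ q); last by ring.
rewrite [ph (a + _ - _ - a) _ _](@ph_rev _ _ _ h_odd q); last by ring.
rewrite (_ : (3 * (i + t)).+1 = i + (i + t).+1 + (t + (i + t)))%N; last by lia.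
rewrite (@phD _ _ _ (a + (4 * i + 2 * t + 2)%:R * q) a); last by ring.
rewrite [ph a q2 (i + _)](@phD _ _ _ (a + (2 * i)%:R * q)); last by ring.
rewrite (_ : (i + t + (i + t)) = t.*2 + i + i)%N; last by lia.
rewrite [ph q q _](@phD _ _ _ ((t + t + i + 1)%:R * q)); last by rewrite -addnn; ring.
rewrite [ph q q (_ + _)](@phD _ _ _ ((t + t + 1)%:R * q)); last by rewrite -addnn; ring.
rewrite [ph q q _](@ph_double _ _ _ q2 q2) //.
rewrite [ph b q2 (i + t)](@phD _ _ _ (b + (2 * i)%:R * q)); last by ring.
rewrite [ph c q2 (i + t)](@phD _ _ _ (c + (2 * i)%:R * q)); last by ring.
rewrite [ph (b + q - (a + _)) _ _](@ph_rev _ _ _ h_odd (c - (2 * t)%:R * q)); last first.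
  by rewrite eb; ring.
have -> : b + q - (t + t + 1)%:R * q = b - (2 * t)%:R * q by ring.
have -> : a + (2 + 2 * (i + t))%:R * q - (a + (2 * i)%:R * q) = (2 + 2 * t)%:R * q by ring.
have -> : a + (2 + 2 * (i + t))%:R * q - (t + t + 1)%:R * q = a + (2 * i + 1)%:R * q by ring.
rewrite exprD; ring.
Qed.

Lemma lsum_B_even r a b c e f : (forall m, (m <= r.*2)%N -> Aprop m) ->
  gen a -> gen c -> gen (c - a) -> b + c = a + q -> e + f = a + (r.*2 + 1)%:R * q ->
  lsum r.*2 a b c a e f = Bprod r a b c e f.
Proof.
move=> HA ga gc gca E Ef; pose s := a + (r.*2 + 1)%:R * q.
have -> : f = s - e by rewrite /s -Ef; ring.
move: e {f Ef}; apply: (theta_interp (F := F s) _ (F_diag s) (F_anti s) (z := fun i => a + (2 * i)%:R * q)).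
- exact: h_plucker.
- exact: theta_lsum_e.
- exact: theta_Bprod.
- by move=> i j _ ji; apply: gen_node.
move=> i ir; have [m nm] : exists m, r.*2 = (i + m)%N by exists (r.*2 - i)%N; lia.
have -> : s - (a + (2 * i)%:R * q) = (m + 1)%:R * q - i%:R * q by rewrite /s nm; ring.
rewrite nm lsum_node //; last 2 first.
- by apply: HA; lia.
- by rewrite E; ring.
have [ri | ri] := leqP i r.
  have [t rt] : exists t, r = (i + t)%N by exists (r - i)%N; lia.
  have mt : m = (i + t.*2)%N by lia.
  by rewrite mt rt; apply: Bprod_node.
(* Beyond the middle node both sides vanish, each by a factor [h 0]. *)
have l1 : (i - m.+1 < i)%N by lia.
have l2 : (i - r.+1 < r)%N by lia.
rewrite [ph ((m + 1)%:R * q - _) q i](ph_eq0 h00 l1); last by rewrite natrB; [ring|lia].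
rewrite /Bprod [ph (a + _ - (a + _)) _ _](ph_eq0 h00 l2); last by rewrite natrB; [ring|lia].
by rewrite !(mulr0, mul0r).
Qed.

(** For odd length all node values are 0: up to the middle because of the product belonging to d =
    a, beyond it because of the product that starts at (m + 1 - i) q. *)
Lemma lsum_B_odd r a b c e f : (forall m, (m <= r.*2.+1)%N -> Aprop m) ->
  gen a -> gen c -> gen (c - a) -> b + c = a + q -> e + f = a + (r.*2.+1 + 1)%:R * q ->
  lsum r.*2.+1 a b c a e f = 0.
Proof.
move=> HA ga gc gca E Ef; pose s := a + (r.*2.+1 + 1)%:R * q.
have -> : f = s - e by rewrite /s -Ef; ring.
move: e {f Ef}; apply: (theta_interp0 (F := F s) _ (F_diag s) (F_anti s) (z := fun i => a + (2 * i)%:R * q)).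
- exact: h_plucker.
- exact: theta_lsum_e.
- by move=> i j _ ji; apply: gen_node.
move=> i ir; have [m nm] : exists m, r.*2.+1 = (i + m)%N by exists (r.*2.+1 - i)%N; lia.
have -> : s - (a + (2 * i)%:R * q) = (m + 1)%:R * q - i%:R * q by rewrite /s nm; ring.
rewrite nm lsum_node //; last 2 first.
- by apply: HA; lia.
- by rewrite E; ring.
have [ri | ri] := leqP i r.
  have l1 : (r - i < m)%N by lia.
  rewrite [ph (a + _ - _ - a) _ _](ph_eq0 h00 l1); first by rewrite !(mulr0, mul0r).
  have -> : m = (r.*2.+1 - i)%N by lia.
  by rewrite !natrB ?[r.*2.+1%:R]mulrS -?addnn; [ring | lia | lia].
have l1 : (i - m.+1 < i)%N by lia.
rewrite [ph ((m + 1)%:R * q - _) q i](ph_eq0 h00 l1); last by rewrite natrB; [ring|lia].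
by rewrite !(mulr0, mul0r).
Qed.

(** Reversing the second product turns the left-hand side into one run of 2n consecutive arguments
    from u - n q on, up to sign. Its two parity classes give the right-hand side after one more
    reversal with the same sign. *)
Lemma ph_reflect n u :
  ph u q n * ph (q - u) q n = ph (u - n%:R * q) q2 n * ph (q - u - n%:R * q) q2 n.
Proof.
rewrite [ph (q - u) q n](@ph_rev _ _ _ h_odd (u - n%:R * q)); last by ring.
rewrite [ph (q - u - _) q2 n](@ph_rev _ _ _ h_odd (u - n%:R * q + q)); last by ring.
have := @ph_double _ _ h q2 (u - n%:R * q + q) (u - n%:R * q) q n erefl erefl.
rewrite -addnn (@phD _ _ _ u); last by ring.
by move=> H; rewrite mulrCA [ph u q n * _]mulrC H mulrCA.
Qed.

(** Here d = 0, multiplicatively d = 1: every term with k > 0 contains [h 0], and [ph_reflect]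
    evaluates the term k = 0. *)
Lemma Aprod_node0 n a b c : b + c = a + a + q ->
  lsum n a b c 0 a ((n + 1)%:R * q) = Aprod n a b c 0.
Proof.
move=> E; rewrite /lsum big_ord_recl big1 ?addr0; last first.
  move=> i _; rewrite [X in _ * X * _](_ : _ = 0) ?mulr0 ?mul0r //.
  rewrite [xfac a n _ 0]/xfac (@ph_eq0 _ _ _ h00 0 0) ?mul0r ?mulr0 //.
  by ring.
rewrite /xfac /yfac /Aprod /= !ph0 !subn0 !mul1r muln0 !addn0 !mul0r !addr0 !mulr1 !subr0.
rewrite (@phSl _ _ _ (a + q)) //.
have -> : a + 2 * q - a = q2 by ring.
have -> : a + 2 * q - (n + 1)%:R * q = a + q - n%:R * q by ring.
have H : ph (a + q - b) q n * ph (a + q - c) q n =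
    ph (a + q - n%:R * q - b) q2 n * ph (a + q - n%:R * q - c) q2 n.
  have := ph_reflect n (a + q - b).
  have -> : q - (a + q - b) = a + q - c.
    by rewrite (_ : c = a + a + q - b); [ring | rewrite -E; ring].
  by move=> ->; congr (ph _ _ _ * ph _ _ _); ring.
transitivity (h a * ph (a + (n + 2)%:R * q) q2 n * (ph (a + q - b) q n * ph (a + q - c) q n *
  ph (a + q) q n) * (ph q2 q2 n * ph (a + q - n%:R * q) q2 n)); first by ring.
by rewrite H; ring.
Qed.

(** The node d = a + s q for even n - s = 2r: the prefactor produced by [lsum_shift], times the
    value of the shorter sum, in which d has become the new a. *)
Lemma Aprod_node s r n a b c : n = (s + r.*2)%N -> b + c + s%:R * q = a + q ->
  ph (- (n%:R * q)) q s * (ph b q2 s * ph c q2 s * ph (a + s%:R * q) q2 s) *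
    (ph a q s * ph ((n + 1)%:R * q) q s) *
  Bprod r (a + (3 * s)%:R * q) (b + (2 * s)%:R * q) (c + (2 * s)%:R * q)
    (a + s%:R * q) ((n + 1)%:R * q + s%:R * q) =
  Aprod n a b c (a + s%:R * q).
Proof.
move=> En E; have eb : b = a + q - c - s%:R * q by rewrite -E; ring.
rewrite /Bprod /Aprod.
rewrite (@ph_rev _ _ _ h_odd ((r.*2 + 1)%:R * q) (- _)); last by rewrite En; ring.
have -> : b + (2 * s)%:R * q + q - (a + s%:R * q) = q2 - c by rewrite eb; ring.
rewrite [ph (q2 - c) _ _](@ph_rev _ _ _ h_odd (c - r.*2%:R * q)); last by rewrite -addnn; ring.
have -> : b + (2 * s)%:R * q + q - ((n + 1)%:R * q + s%:R * q) = b - r.*2%:R * q.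
  by rewrite En; ring.
have -> : a + (3 * s)%:R * q + (2 + 2 * r)%:R * q - (a + s%:R * q) = (2 * s + 2 * r + 2)%:R * q.
  by ring.
have -> : a + (3 * s)%:R * q + (2 + 2 * r)%:R * q - ((n + 1)%:R * q + s%:R * q) =
  a + (s + 1)%:R * q by rewrite En -addnn; ring.
have Ea : ph (a + s%:R * q) q2 s * ph (a + (3 * s)%:R * q) q2 (3 * r).+1 =
   ph (a + s%:R * q) q2 r.+1 * ph (a + (n + 2)%:R * q) q2 n.
  rewrite -(@phD _ _ _ (a + (3 * s)%:R * q)); last by ring.
  rewrite -(@phD _ _ _ (a + (n + 2)%:R * q)); last by rewrite En -addnn; ring.
  by congr (ph _ _ _); lia.
have En2 : ph q q r.*2 * ph ((r.*2 + 1)%:R * q) q s * ph ((n + 1)%:R * q) q s =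
  ph q q2 (s + r) * ph q2 q2 (s + r).
  rewrite -(@phD _ _ _ ((r.*2 + 1)%:R * q)); last by ring.
  rewrite -(@phD _ _ _ ((n + 1)%:R * q)); last by rewrite En; ring.
  by rewrite -(@ph_double _ _ _ q2 q2 q q) //; congr (ph _ _ _); lia.
have -> : n.+1 = (s + r.*2.+1)%N by rewrite En addnS.
rewrite [ph a q (s + _)](@phD _ _ _ (a + s%:R * q)) //.
rewrite [ph _ q r.*2.+1](@ph_doubleS _ _ _ q2 (a + (s + 1)%:R * q)) //; last by ring.
have Er : n = (s + r + r)%N by rewrite En -addnn addnA.
have -> : ph q2 q2 n = ph q2 q2 (s + r) * ph ((2 * s + 2 * r + 2)%:R * q) q2 r.
  by rewrite Er; apply: phD; ring.
have ebc x y : a + q - n%:R * q - x = y - r.*2%:R * q ->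
   ph (a + q - n%:R * q - x) q2 n = ph (y - r.*2%:R * q) q2 r * ph y q2 s * 
   ph (y + (2 * s)%:R * q) q2 r.
  move=> ->; rewrite (_ : n = r + s + r)%N; last by lia.
  rewrite (@phD _ _ _ (y + (2 * s)%:R * q)); last by rewrite -addnn; ring.
  by rewrite (@phD _ _ _ y) // -addnn; ring.
rewrite (ebc b c); last by rewrite eb En; ring.
rewrite (ebc c b); last by rewrite eb En; ring.
have -> : ph (a + q - n%:R * q - (a + s%:R * q)) q2 n = (-1) ^+ (s + r) * ph q q2 (s + r) * ph q q2 r.
  rewrite -(@ph_rev _ _ _ h_odd q (a + q - n%:R * q - (a + s%:R * q))); last by rewrite En -addnn; ring.
  by rewrite [X in ph _ _ X = _]Er; apply: phD; rewrite En -addnn; ring.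
rewrite exprD.
transitivity ((-1) ^+ s * (-1) ^+ r * (ph (a + s%:R * q) q2 s * ph (a + (3 * s)%:R * q) q2 (3 * r).+1) *
   (ph q q r.*2 * ph ((r.*2 + 1)%:R * q) q s * ph ((n + 1)%:R * q) q s) *
   ph a q s * ph b q2 s * ph c q2 s * ph q q2 r * ph (b + (2 * s)%:R * q) q2 r *
   ph (c + (2 * s)%:R * q) q2 r * ph (c - r.*2%:R * q) q2 r * ph (b - r.*2%:R * q) q2 r *
   ph ((2 * s + 2 * r + 2)%:R * q) q2 r * ph (a + (s + 1)%:R * q) q2 r); first by ring.
rewrite Ea En2; ring.
Qed.

Lemma theta_Aprod s n a c : theta_deg (F s) n (fun d => Aprod n a (s - d) c d).
Proof.
have := theta_scale (ph a q n.+1 * ph (a + (n + 2)%:R * q) q2 n * ph q2 q2 n *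
  ph (a + q - n%:R * q - c) q2 n) (@theta_ph_sub s (a + q - n%:R * q) q2 n).
by move/theta_ext; apply => d; rewrite /Aprod; ring.
Qed.

Lemma lsum_A n : Aprop n.
Proof.
have [m] := ubnP n; elim: m n => // m IH n; rewrite ltnS => nm a b c d ga gc gca E.
pose s := a + a + q - c.
have -> : b = s - d by rewrite /s -E; ring.
move: d {E}; apply: (theta_interp (F := F s) _ (F_diag s) (F_anti s)
  (z := fun i => if i is j.+1 then a + j.+1%:R * q else 0)).
- exact: h_plucker.
- exact: theta_lsum_d.
- exact: theta_Aprod.
(* Two nodes could also coincide through z_i + z_j = s. The genericity of [c - a] excludes this for
   pairs with the node 0, that of [c] for the other pairs. *)
- move=> [//|i] [|j] iln ji; rewrite mulf_neq0 //.
  + by have := ga i.+1 0; congr (h _ != 0); ring.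
  + by have := gca i.+1 1; congr (h _ != 0); rewrite /s; ring.
  + have := @hq i.+1 j.+1; rewrite gt_eqF // => /(_ isT).
    by congr (h _ != 0); ring.
  + by have := gc (i.+1 + j.+1)%N 1; congr (h _ != 0); rewrite /s; ring.
move=> [|i] iln.
  by rewrite subr0; apply: Aprod_node0; rewrite /s; ring.
move: i.+1 (ltn0Sn i) iln => {i} t t0 tn; set b' := s - _.
have [r nr] : exists r, n = (t + r)%N by exists (n - t)%N; rewrite subnKC.
rewrite (@lsum_shift _ t r) //; last first.
  by move=> k kt; left; apply: xfac_eq0; rewrite kt.
rewrite (_ : a + t%:R * q + (2 * t)%:R * q = a + (3 * t)%:R * q); last by ring.
have ga' : gen (a + (3 * t)%:R * q) by apply: (gen_shift ga).
have gc' : gen (c + (2 * t)%:R * q) by apply: (gen_shift gc).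
have gca' : gen (c + (2 * t)%:R * q - (a + (3 * t)%:R * q)).
  by apply: (gen_shiftN (i := t) gca); ring.
have E' : b' + (2 * t)%:R * q + (c + (2 * t)%:R * q) = a + (3 * t)%:R * q + q.
  by rewrite /b' /s; ring.
(* For odd remaining length both sides are 0; for even length [lsum_B_even] evaluates the shorter
   sum. *)
have rE := odd_double_half r; case: (odd r) rE => /= rE.
  rewrite add1n in rE; rewrite -rE lsum_B_odd ?mulr0 //; last 2 first.
  - by move=> k kr; apply: IH; lia.
  - by rewrite rE nr; ring.
  have lt : (r./2 + t < n)%N by lia.
  rewrite /Aprod [ph (a + q - _ - (a + _)) q2 n](ph_eq0 h00 lt) ?mulr0 //.
  have -> : n%:R = (t + (r./2 + r./2).+1)%:R :> G by rewrite addnn rE nr.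
  by ring.
have {}rE : r./2.*2 = r by [].
rewrite -{1}rE lsum_B_even //; last 2 first.
- by move=> k kr; apply: IH; lia.
- by rewrite rE nr; ring.
by apply: Aprod_node; [rewrite rE | rewrite /b' /s; ring].
Qed.

(* [rsum] is the right-hand side multiplied by the same denominators as in [lsum]. *)
Definition Bcoef n a j : K :=
  ph a q n.+1 * ph (a + (n + 2)%:R * q) q2 n * ph (- (n%:R * q)) q j.*2 *
  h (a + (4 * j)%:R * q - (n + 1)%:R * q) /
  (ph (a + (2 * j)%:R * q - (n + 1)%:R * q) q2 (n - j).+1 * ph q2 q2 j * ph a q j.*2).
Definition xfac' a n j x : K :=
  ph x q2 j * ph (a + (1 + 2 * j)%:R * q - n%:R * q - x) q2 (n - j).
Definition yfac' a n j y : K :=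
  ph (a - y) q2 j * ph (a + (2 + 2 * j)%:R * q - y) q2 (n - j).
Definition rsum n a b c d e f : K := \sum_(j < n./2.+1)
  Bcoef n a j * (xfac' a n j b * xfac' a n j c * xfac' a n j d) *
  (yfac' a n j e * yfac' a n j f).

Lemma theta_rsum s n a b c d : theta_deg (F s) n (fun e => rsum n a b c d e (s - e)).
Proof.
apply: theta_sum => j _; apply: theta_scale.
have jn : (j <= n)%N by have := leq_ord j; lia.
have := theta_mul (theta_ph_sub s a q2 j) (theta_ph_sub s (a + (2 + 2 * j)%:R * q) q2 (n - j)).
rewrite subnKC // => /theta_ext; apply => e; rewrite /yfac'; ring.
Qed.

(** This makes the right-hand side diagonal at the nodes: for i < j the first product contains
    [h 0], for i > j the second one does. *)
Lemma yfac'_eq0 a n i j : (j <= n)%N -> (i <= n)%N -> i != j ->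
  yfac' a n j (a + (2 * i)%:R * q) = 0.
Proof.
move=> jn i_n; rewrite neq_ltn => /orP [ij|ji]; rewrite /yfac'.
  by rewrite [ph (a - _) _ _](ph_eq0 h00 ij) ?mul0r //; ring.
have lt : (i - j.+1 < n - j)%N by lia.
by rewrite [X in _ * X](ph_eq0 h00 lt) ?mulr0 // natrB //; ring.
Qed.

(** Comparison of the parts free of b, c, d in [lsum_node] and in the diagonal term of [rsum]. The
    auxiliary equations cut one run of arguments in two ways; [E4] also reverses a piece, and its
    sign meets an equal one from [ph_rev]. *)
Lemma Bcoef_node n i m a : n = (i + m)%N -> gen a ->
  ph (- (n%:R * q)) q i * ph ((m + 1)%:R * q - i%:R * q) q i *
  ph (a + (2 * i)%:R * q) q n.+1 * ph (a + (3 * i + m + 2)%:R * q) q2 m * ph q2 q2 m =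
  Bcoef n a i * (yfac' a n i (a + (2 * i)%:R * q) * yfac' a n i ((m + 1)%:R * q - i%:R * q)).
Proof.
move=> En ga; rewrite /Bcoef /yfac'.
have -> : (n - i = m)%N by lia.
have -> : a - (a + (2 * i)%:R * q) = - ((2 * i)%:R * q) by ring.
rewrite [ph (- ((2 * i)%:R * q)) _ _](@ph_rev _ _ _ h_odd q2); last by ring.
have -> : a + (2 + 2 * i)%:R * q - (a + (2 * i)%:R * q) = q2 by ring.
have -> : a + (2 + 2 * i)%:R * q - ((m + 1)%:R * q - i%:R * q) =
  a + (3 * i + 1)%:R * q - m%:R * q by ring.
have -> : a + (2 * i)%:R * q - (n + 1)%:R * q = a - ((m + 1)%:R * q - i%:R * q).
  by rewrite En; ring.
set u := a - _.
have E1 : ph u q2 i * h (a + (4 * i)%:R * q - (n + 1)%:R * q) *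
    ph (a + (3 * i + 1)%:R * q - m%:R * q) q2 m =
    ph u q2 m.+1 * ph (a + (n + 1)%:R * q) q2 i.
  rewrite -mulrA -(@phSl _ _ _ _ _ q2); last by rewrite En; ring.
  rewrite -(@phD _ _ _ _ u); last by rewrite /u En; ring.
  rewrite -(@phD _ _ _ _ u); last by rewrite /u En; ring.
  by congr (ph _ _ _); lia.
have E2 : ph a q i.*2 * ph (a + (2 * i)%:R * q) q n.+1 = ph a q n.+1 *
   (ph (a + (n + 1)%:R * q) q2 i * ph (a + (n + 2)%:R * q) q2 i).
  rewrite -(@phD _ _ _ _ a); last by rewrite -addnn; ring.
  rewrite -(@ph_double _ _ _ q2 _ (a + (n + 1)%:R * q) q) //; last by ring.
  by rewrite -(@phD _ _ _ _ a); [congr (ph _ _ _); lia | ring].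
have E3 : ph (a + (n + 2)%:R * q) q2 n =
  ph (a + (n + 2)%:R * q) q2 i * ph (a + (3 * i + m + 2)%:R * q) q2 m.
  by rewrite {2}En; apply: phD; rewrite En; ring.
have E4 : ph (- (n%:R * q)) q i.*2 =
  ph (- (n%:R * q)) q i * ((-1) ^+ i * ph ((m + 1)%:R * q - i%:R * q) q i).
  rewrite -(@ph_rev _ _ _ h_odd _ (- (m%:R * q))); last by ring.
  by rewrite -addnn; apply: phD; rewrite En; ring.
have n1 : ph u q2 m.+1 != 0.
  apply: ph_neq0 => k _; have := ga (i + 2 * k)%N (m + 1)%N.
  by congr (h _ != 0); rewrite /u; ring.
have n2 : ph q2 q2 i != 0.
  apply: ph_neq0 => k _; have := @hq (2 * k + 2) 0; rewrite addn2 => /(_ isT).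
  by congr (h _ != 0); ring.
have n3 : ph a q i.*2 != 0.
  by apply: ph_neq0 => k _; have := ga k 0; congr (h _ != 0); ring.
set D := _ * _ * ph a q i.*2.
have nD : D != 0 by rewrite !mulf_neq0.
apply: (mulIf nD); rewrite [RHS]mulrAC divfK //.
transitivity (ph (- (n%:R * q)) q i * ph ((m + 1)%:R * q - i%:R * q) q i *
  (ph a q i.*2 * ph (a + (2 * i)%:R * q) q n.+1) * ph (a + (3 * i + m + 2)%:R * q) q2 m * 
  ph q2 q2 m * ph u q2 m.+1 * ph q2 q2 i); first by rewrite /D; ring.
rewrite E2 E3 E4.
transitivity (((-1) ^+ i * (-1) ^+ i) * ph (- (n%:R * q)) q i * ph ((m + 1)%:R * q - i%:R * q) q i *
  ph a q n.+1 * ph (a + (n + 2)%:R * q) q2 i *  ph (a + (3 * i + m + 2)%:R * q) q2 m * ph q2 q2 m *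
  ph q2 q2 i * (ph u q2 m.+1 * ph (a + (n + 1)%:R * q) q2 i)); last by rewrite -E1; ring.
rewrite -exprD addnn -signr_odd odd_double expr0; ring.
Qed.

Theorem lsum_rsum n a b c d e f : gen a -> gen c -> gen (c - a) ->
  b + c + d = a + a + q -> e + f = a + (n + 1)%:R * q ->
  lsum n a b c d e f = rsum n a b c d e f.
Proof.
move=> ga gc gca E Ef; pose s := a + (n + 1)%:R * q.
have -> : f = s - e by rewrite /s -Ef; ring.
move: e {f Ef}; apply: (theta_interp (F := F s) _ (F_diag s) (F_anti s) (z := fun i => a + (2 * i)%:R * q)).
- exact: h_plucker.
- exact: theta_lsum_e.
- exact: theta_rsum.
- by move=> i j _ ji; apply: gen_node.
move=> i i_n; have [m nm] : exists m, n = (i + m)%N by exists (n - i)%N; rewrite subnKC.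
have -> : s - (a + (2 * i)%:R * q) = (m + 1)%:R * q - i%:R * q by rewrite /s nm; ring.
rewrite [in LHS]nm lsum_node //; last exact: lsum_A.
have jn (j : 'I_n./2.+1) : (j <= n)%N by have := leq_ord j; lia.
(* For i > n/2 the right-hand side has no term j = i, so it vanishes; the left-hand side contains
   [h 0]. *)
have [i2 | i2] := leqP i n./2; last first.
  have l1 : (i - m.+1 < i)%N by lia.
  rewrite [ph ((m + 1)%:R * q - _) q i](ph_eq0 h00 l1); last by rewrite natrB; [ring|lia].
  rewrite !(mulr0, mul0r) /rsum big1 // => j _.
  rewrite yfac'_eq0 ?(mul0r, mulr0) //.
  by have := leq_ord j; lia.
rewrite /rsum (bigD1 (Ordinal (i2 : (i < n./2.+1)%N))) //= [X in _ = _ + X]big1 ?addr0; last first.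
  move=> j; rewrite -val_eqE /= => ji; rewrite yfac'_eq0 ?(mul0r, mulr0) //.
  by rewrite eq_sym.
rewrite -nm (Bcoef_node nm ga) mulrAC; congr (_ * _ * _).
have ex x : ph (a + (1 + i)%:R * q - m%:R * q - x) q2 m =
  ph (a + (1 + 2 * i)%:R * q - n%:R * q - x) q2 m.
  by congr (ph _ _ _); rewrite nm; ring.
by rewrite !ex /xfac'; have -> : (n - i = m)%N by lia.
Qed.

(** * From cleared denominators back to quotients *)

Lemma half_leq n : (n./2 <= n)%N.
Proof. lia. Qed.

Lemma ph_neq0_le x Q m n : (m <= n)%N -> ph x Q n != 0 -> ph x Q m != 0.
Proof.
move=> mn; rewrite -(subnKC mn) (@phD _ _ _ (x + m%:R * Q)) //.
by rewrite mulf_eq0 negb_or => /andP [].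
Qed.

Lemma ph_split k n x y Q : (k <= n)%N -> y = x + k%:R * Q -> ph x Q n = ph x Q k * ph y Q (n - k).
Proof. by move=> kn e; rewrite -(@phD _ _ _ y) // subnKC. Qed.

(** There is no counterpart of [q ^+ k]: that power cancels against the monomials split off from the
    theta functions, see [lhs_conv]. *)
Definition quad_lhs n a b c d e f : K := \sum_(k < n.+1)
  (h (a + (3 * k)%:R * q) / h a) *
  (ph b q2 k * ph c q2 k * ph d q2 k /
     (ph (a + q - b) q k * ph (a + q - c) q k * ph (a + q - d) q k)) *
  (ph e q k * ph f q k * ph (- (n%:R * q)) q k /
     (ph (a + q2 - e) q2 k * ph (a + q2 - f) q2 k * ph (a + (n + 2)%:R * q) q2 k)).

Definition quad_rhs n a b c d e f : K :=
  (ph (a + q) q n * ph (a + q - b - c) q n *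
     (ph (a + q - n%:R * q - b) q2 n * ph (a + q - n%:R * q - c) q2 n)) /
  (ph (a + q - b) q n * ph (a + q - c) q n *
     (ph (a + q - n%:R * q) q2 n * ph (a + q - n%:R * q - b - c) q2 n)) *
  \sum_(j < n./2.+1)
    (h (a - (n + 1)%:R * q + (4 * j)%:R * q) / h (a - (n + 1)%:R * q)) *
    (ph (a - (n + 1)%:R * q) q2 j * (ph b q2 j * ph c q2 j * ph d q2 j) *
      (ph (a - e) q2 j * ph (a - f) q2 j) * (ph (q - n%:R * q) q2 j * ph (- (n%:R * q)) q2 j)) /
    (ph q2 q2 j * (ph (a + q - n%:R * q - b) q2 j * ph (a + q - n%:R * q - c) q2 j *
       ph (a + q - n%:R * q - d) q2 j) *
      (ph (a + q2 - e) q2 j * ph (a + q2 - f) q2 j) * (ph a q2 j * ph (a + q) q2 j)).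

Definition quad_den n a b c d e f : K :=
  h a * (ph (a + q - b) q n * ph (a + q - c) q n * ph (a + q - d) q n) *
  (ph (a + q2 - e) q2 n * ph (a + q2 - f) q2 n * ph (a + (n + 2)%:R * q) q2 n).

Lemma quad_lhs_lsum n a b c d e f : quad_den n a b c d e f != 0 ->
  quad_lhs n a b c d e f * quad_den n a b c d e f = lsum n a b c d e f.
Proof.
rewrite /quad_den !mulf_eq0 !negb_or => /andP [/andP [na /andP [/andP [nb nc] nd]]].
move=> /andP [/andP [ne nf] nn].
rewrite /quad_lhs big_distrl /=; apply: eq_bigr => k _; have kn := leq_ord k.
have sx x : ph (a + q - x) q n = ph (a + q - x) q k * ph (a + (1 + k)%:R * q - x) q (n - k).
  by apply: ph_split => //; ring.
have sy y : ph (a + q2 - y) q2 n = ph (a + q2 - y) q2 k * ph (a + (2 + 2 * k)%:R * q - y) q2 (n - k).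
  by apply: ph_split => //; ring.
have sn : ph (a + (n + 2)%:R * q) q2 n = ph (a + (n + 2)%:R * q) q2 k *
    ph (a + (n + 2 + 2 * k)%:R * q) q2 (n - k) by apply: ph_split => //; ring.
have := ph_neq0_le kn nb; have := ph_neq0_le kn nc; have := ph_neq0_le kn nd.
have := ph_neq0_le kn ne; have := ph_neq0_le kn nf; have := ph_neq0_le kn nn.
move=> nn' nf' ne' nd' nc' nb'.
rewrite !sx !sy sn /xfac /yfac; field.
by rewrite na nb' nc' nd' ne' nf' nn'.
Qed.

Lemma quad_rhs_rsum n a b c d e f : gen a -> quad_den n a b c d e f != 0 ->
  b + c + d = a + a + q -> e + f = a + (n + 1)%:R * q ->
  ph (a + q - n%:R * q - b - c) q2 n != 0 ->
  ph (a + q - n%:R * q - b) q2 n./2 != 0 -> ph (a + q - n%:R * q - c) q2 n./2 != 0 ->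
  ph (a + q - n%:R * q - d) q2 n./2 != 0 ->
  quad_rhs n a b c d e f * quad_den n a b c d e f = rsum n a b c d e f.
Proof.
move=> ga; rewrite /quad_den !mulf_eq0 !negb_or => /andP [/andP [na /andP [/andP [nb nc] nd]]].
move=> /andP [/andP [ne nf] nn] E Ef nbc nb2 nc2 nd2.
have gph x Q m : (forall i, exists j k, x + i%:R * Q = a + j%:R * q - k%:R * q) -> ph x Q m != 0.
  by move=> H; apply: ph_neq0 => i _; have [j [k ->]] := H i.
set a1 := a - (n + 1)%:R * q.
have nA : ph (a + q - n%:R * q) q2 n != 0.
  by apply: gph => i; exists (2 * i + 1)%N, n; ring.
have na1 : h a1 != 0 by have := ga 0 (n + 1)%N; congr (h _ != 0); rewrite /a1; ring.
(* The prefactor singles out b and c. By [ph_reflect] its factors in a + q - b - c become factors in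
   d, which restores the symmetry in b, c, d of [rsum]. *)
have R1 : ph (a + q - b - c) q n / ph (a + q - n%:R * q - b - c) q2 n =
    ph (a + q - n%:R * q - d) q2 n / ph (a + q - d) q n.
  have := ph_reflect n (a + q - d).
  have -> : q - (a + q - d) = a + q - b - c.
    by rewrite (_ : d = a + a + q - b - c); [ring | rewrite -E; ring].
  have -> : a + q - b - c - n%:R * q = a + q - n%:R * q - b - c by ring.
  have -> : a + q - d - n%:R * q = a + q - n%:R * q - d by ring.
  by move=> H; apply/eqP; rewrite eqr_div // mulrC H.
rewrite /quad_rhs !big_distrr big_distrl /=; apply: eq_bigr => j _.
have j2 := leq_ord j; have jn := leq_trans j2 (half_leq n).
have sx x : ph (a + q - n%:R * q - x) q2 n =
    ph (a + q - n%:R * q - x) q2 j * ph (a + (1 + 2 * j)%:R * q - n%:R * q - x) q2 (n - j).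
  by apply: ph_split => //; ring.
have sy y : ph (a + q2 - y) q2 n = ph (a + q2 - y) q2 j * ph (a + (2 + 2 * j)%:R * q - y) q2 (n - j).
  by apply: ph_split => //; ring.
(* As a1 + q2 = a + q - n q, both sides are the run of n + 1 arguments from [a1] on, cut
   differently. *)
have s1 : ph a1 q2 j * ph (a + (2 * j)%:R * q - (n + 1)%:R * q) q2 (n - j).+1 =
    h a1 * ph (a + q - n%:R * q) q2 n.
  rewrite -(@phSl _ _ _ _ a1); last by rewrite /a1; ring.
  rewrite -(@phD _ _ _ _ a1); last by rewrite /a1; ring.
  by rewrite addnS subnKC.
have -> : a1 + (4 * j)%:R * q = a + (4 * j)%:R * q - (n + 1)%:R * q by rewrite /a1; ring.
rewrite /Bcoef /xfac' /yfac'.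
rewrite (@phSl _ _ _ (a + q) a) //.
rewrite (@ph_double _ _ _ q2 (q - n%:R * q) (- (n%:R * q))) //; last by ring.
rewrite (@ph_double _ _ _ q2 (a + q) a) //.
have nb' := ph_neq0_le j2 nb2; have nc' := ph_neq0_le j2 nc2; have nd' := ph_neq0_le j2 nd2.
have ne' := ph_neq0_le jn ne; have nf' := ph_neq0_le jn nf.
have n1 : ph a q2 j != 0 by apply: gph => i; exists (2 * i)%N, 0%N; ring.
have n2 : ph (a + q) q2 j != 0 by apply: gph => i; exists (2 * i + 1)%N, 0%N; ring.
have n3 : ph q2 q2 j != 0.
  apply: ph_neq0 => k _; have := @hq (2 * k + 2) 0; rewrite addn2 => /(_ isT).
  by congr (h _ != 0); ring.
have n4 : ph (a + (2 * j)%:R * q - (n + 1)%:R * q) q2 (n - j).+1 != 0.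
  by apply: gph => i; exists (2 * j + 2 * i)%N, (n + 1)%N; ring.
have s2 : ph a1 q2 j / h a1 / ph (a + q - n%:R * q) q2 n =
    (ph (a + (2 * j)%:R * q - (n + 1)%:R * q) q2 (n - j).+1)^-1.
  apply: (mulIf n4); rewrite mulVf //; transitivity ((h a1 * ph (a + q - n%:R * q) q2 n) /
    h a1 / ph (a + q - n%:R * q) q2 n); first by rewrite -s1; ring.
  by field; rewrite nA na1.
transitivity ((ph a1 q2 j / h a1 / ph (a + q - n%:R * q) q2 n) *
  (ph (a + q - b - c) q n / ph (a + q - n%:R * q - b - c) q2 n) *
  (ph (a + q) q n * (ph (a + q - n%:R * q - b) q2 n * ph (a + q - n%:R * q - c) q2 n) *
   h (a + (4 * j)%:R * q - (n + 1)%:R * q) * (ph b q2 j * ph c q2 j * ph d q2 j) *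
   (ph (a - e) q2 j * ph (a - f) q2 j) * (ph (q - n%:R * q) q2 j * ph (- (n%:R * q)) q2 j) /
    (ph q2 q2 j * (ph (a + q - n%:R * q - b) q2 j * ph (a + q - n%:R * q - c) q2 j *
       ph (a + q - n%:R * q - d) q2 j) *
      (ph (a + q2 - e) q2 j * ph (a + q2 - f) q2 j) * (ph a q2 j * ph (a + q) q2 j)) *
   (h a * ph (a + q - d) q n) *
   (ph (a + q2 - e) q2 n * ph (a + q2 - f) q2 n * ph (a + (n + 2)%:R * q) q2 n))).
  field.
  by rewrite na1 nA nbc nb nc nb' nc' nd' ne' nf' n1 n2 n3.
rewrite s2 R1 !sx !sy; field.
by rewrite nd n4 n3 nb' nc' nd' ne' nf' n1 n2.
Qed.

Lemma quad_transform n a b c d e f : gen a -> gen c -> gen (c - a) ->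
  quad_den n a b c d e f != 0 ->
  b + c + d = a + a + q -> e + f = a + (n + 1)%:R * q ->
  ph (a + q - n%:R * q - b - c) q2 n != 0 ->
  ph (a + q - n%:R * q - b) q2 n./2 != 0 -> ph (a + q - n%:R * q - c) q2 n./2 != 0 ->
  ph (a + q - n%:R * q - d) q2 n./2 != 0 ->
  quad_lhs n a b c d e f = quad_rhs n a b c d e f.
Proof.
move=> ga gc gca nD E Ef *; apply: (mulIf nD).
by rewrite quad_lhs_lsum // quad_rhs_rsum // lsum_rsum.
Qed.

End Quadratic.

(** * Infinite products and the theta function *)

Import numFieldNormedType.Exports.
Local Open Scope complex_scope.
Local Open Scope classical_set_scope.
Import ComplexField Normc.

Section ComplexSequences.
Variable R : realType.
Local Notation C := R[i].
Implicit Types (u v : nat -> C) (l m x y : C).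

Lemma normcP x : `|x| = (normc x)%:C.
Proof. by rewrite normc_def; case: x. Qed.

Lemma normc_ge0 x : 0 <= normc x.
Proof. by rewrite -lecR -normcP normr_ge0. Qed.

Lemma normc_eq0 x : (normc x == 0) = (x == 0).
Proof. by apply/eqP/eqP => [/eq0_normc //|->]; rewrite normc0. Qed.

Lemma normcX x k : normc (x ^+ k) = normc x ^+ k.
Proof. by elim: k => [|k IH]; rewrite ?expr0 ?normc1 // !exprS normcM IH. Qed.

Lemma normcB x y : normc (x - y) = normc (y - x).
Proof. by rewrite -normcN opprB. Qed.

Lemma ler_normcB x y z : normc (x - z) <= normc (x - y) + normc (y - z).
Proof. by apply: le_trans (le_normcD _ _); rewrite addrA subrK. Qed.

Lemma normc_sum (I : Type) (r : seq I) (P : pred I) (f : I -> C) :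
  normc (\sum_(i <- r | P i) f i) <= \sum_(i <- r | P i) normc (f i).
Proof.
elim/big_rec2: _ => [|i y1 y2 _ H]; first by rewrite normc0.
by apply: le_trans (le_normcD _ _) _; rewrite lerD2l.
Qed.

(** The annotation [C^o] selects the topology in which [Eth] takes its limit. The estimates below
    use the real-valued [normc]. *)
Definition ccvg u l := (u : nat -> C^o) @ \oo --> (l : C^o).

Lemma ccvgP u l : ccvg u l <-> (fun n => normc (u n - l)) @ \oo --> (0 : R).
Proof.
split => [/cvgrPdist_lt H|/cvgrPdist_lt H]; apply/cvgrPdist_lt => e e0.
  have := H e%:C; rewrite ltcR => /(_ e0); apply: filterS => n.
  by rewrite normcP ltcR sub0r normrN ger0_norm ?normc_ge0 // normcB.
(* A positive element of [R[i]] has imaginary part 0, so its real part serves as the tolerance. *)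
move: e0; rewrite ltcE => /andP [/eqP Ie e0]; have := H _ e0; apply: filterS => n.
rewrite sub0r normrN ger0_norm ?normc_ge0 // => lt.
by rewrite normcP ltcE /= Ie eqxx /= normcB.
Qed.

Lemma ccvg_squeeze u l (b : nat -> R) : (forall n, normc (u n - l) <= b n) ->
  b @ \oo --> (0 : R) -> ccvg u l.
Proof.
move=> ub b0; apply/ccvgP; apply: (squeeze_cvgr (f := fun=> 0) (h := b)) => //.
- by near=> n; rewrite normc_ge0 ub.
- exact: cvg_cst.
Unshelve. all: by end_near. Qed.

Lemma ccvg_unique u l m : ccvg u l -> ccvg u m -> l = m.
Proof. by move=> ul um; exact: (@norm_cvg_unique C C^o (u @ \oo) _ l m ul um). Qed.

Lemma ccvgD u v l m : ccvg u l -> ccvg v m -> ccvg (fun n => u n + v n) (l + m).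
Proof. by move=> ul vm; exact: (@cvgD C C^o nat \oo _ u v l m ul vm). Qed.

Lemma ccvgM u v l m : ccvg u l -> ccvg v m -> ccvg (fun n => u n * v n) (l * m).
Proof. by move=> ul vm; exact: (@cvgM C nat \oo _ u v l m ul vm). Qed.

Lemma ccvgV u l : l != 0 -> ccvg u l -> ccvg (fun n => (u n)^-1) l^-1.
Proof. by move=> l0 ul; exact: (@cvgV C nat \oo _ u l l0 ul). Qed.

Lemma ccvg_cst l : ccvg (fun=> l) l.
Proof. exact: cvg_cst. Qed.
Arguments ccvg_cst l : clear implicits.

Lemma ccvgN u l : ccvg u l -> ccvg (fun n => - u n) (- l).
Proof. by move=> ul; exact: (@cvgN C C^o nat \oo _ u l ul). Qed.

Lemma ccvg_sum (I : Type) (r : seq I) (f : I -> nat -> C) (g : I -> C) :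
  (forall i, ccvg (f i) (g i)) -> ccvg (fun n => \sum_(i <- r) f i n) (\sum_(i <- r) g i).
Proof.
move=> H; elim: r => [|i r IH].
  by rewrite big_nil; under eq_fun do rewrite big_nil; exact: ccvg_cst.
by rewrite big_cons; under eq_fun do rewrite big_cons; exact: ccvgD (H i) IH.
Qed.

Lemma ccvg_prod (I : Type) (r : seq I) (f : I -> nat -> C) (g : I -> C) :
  (forall i, ccvg (f i) (g i)) -> ccvg (fun n => \prod_(i <- r) f i n) (\prod_(i <- r) g i).
Proof.
move=> H; elim: r => [|i r IH].
  by rewrite big_nil; under eq_fun do rewrite big_nil; exact: ccvg_cst.
by rewrite big_cons; under eq_fun do rewrite big_cons; exact: ccvgM (H i) IH.
Qed.

Lemma ccvgX u l k : ccvg u l -> ccvg (fun n => u n ^+ k) (l ^+ k).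
Proof.
move=> ul; elim: k => [|k IH]; first exact: ccvg_cst.
by under eq_fun do rewrite exprS; rewrite exprS; exact: ccvgM ul IH.
Qed.

Lemma ccvg_neq0 u l : ccvg u l -> l != 0 -> \forall n \near \oo, u n != 0.
Proof. by move=> ul l0; exact: (@cvgr_neq0 C C^o nat \oo _ u l ul l0). Qed.

Lemma cvg_geom0 (A r : R) : 0 <= r < 1 -> (fun n => A * r ^+ n) @ \oo --> (0 : R).
Proof. by move=> /andP [r0 r1]; apply: cvg_geometric; rewrite ger0_norm. Qed.

Lemma geom_telescope (A r : R) (P : nat -> C) : 0 <= r < 1 -> 0 <= A ->
  (forall n, normc (P n.+1 - P n) <= A * r ^+ n) ->
  forall n k, normc (P (n + k)%N - P n) <= A / (1 - r) * r ^+ n.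
Proof.
move=> /andP [r0 r1] A0 H n k.
have r1' : 0 < 1 - r by lra.
(* The geometric partial sum, unlike its limit, is a bound that passes through the induction on
   k. *)
suff : normc (P (n + k)%N - P n) <= A / (1 - r) * (r ^+ n - r ^+ (n + k)).
  move/le_trans; apply; apply: ler_wpM2l; first by rewrite divr_ge0 // ltW.
  by rewrite gerBl exprn_ge0.
elim: k => [|k IH]; first by rewrite addn0 !subrr normc0 mulr0.
rewrite addnS; apply: le_trans (ler_normcB _ (P (n + k)%N) _) _.
apply: le_trans (lerD (H _) IH) _.
rewrite le_eqVlt; apply/orP; left; apply/eqP; rewrite exprS; field; lra.
Qed.

Lemma geom_cvg (A r : R) (P : nat -> R) : 0 <= r < 1 -> 0 <= A ->
  (forall n, `|P n.+1 - P n| <= A * r ^+ n) ->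
  exists s : R, P @ \oo --> s.
Proof.
move=> r01 A0 H; pose u n := P n.+1 - P n.
have su : series u = (fun n => P n - P 0%N) by apply/funext => n; rewrite /series /= telescope_sumr.
have cu : cvgn (series u).
  apply: normed_cvg; apply: (series_le_cvg (v_ := geometric A r)) => //.
  - by move=> n; apply: normr_ge0.
  - by move=> n; case/andP: r01 => r0 _; apply: mulr_ge0 => //; apply: exprn_ge0.
  - by apply: is_cvg_geometric_series; case/andP: r01 => r0 r1; rewrite ger0_norm.
exists (limn (series u) + P 0%N).
have eP : P = (fun n => series u n + P 0%N) by rewrite su; apply/funext => n; rewrite subrK.
rewrite [X in X @ _]eP.
have c0 : (fun=> P 0%N : R^o) @ \oo --> (P 0%N : R^o) by exact: cvg_cst.
exact: (@cvgD R R^o nat \oo _ _ _ _ _ cu c0).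
Qed.

Lemma ccvg_ext u v l : ccvg u l -> u =1 v -> ccvg v l.
Proof. by move=> ul /funext <-. Qed.

Lemma normc_Re x : `|complex.Re x| <= normc x.
Proof. by rewrite -lecR -normcP normc_ge_Re. Qed.

Lemma normc_Im x : `|complex.Im x| <= normc x.
Proof.
have := normc_Re (x * 'i); rewrite normcM ReiNIm normrN.
by rewrite [normc 'i]/normc expr0n /= expr1n add0r sqrtr1 mulr1.
Qed.

Lemma normc_ReIm x : normc x <= `|complex.Re x| + `|complex.Im x|.
Proof.
rewrite {1}(complexE x) ; apply: le_trans (le_normcD _ _) _; rewrite normcM.
rewrite [normc 'i]/normc expr0n /= expr1n add0r sqrtr1 mul1r.
by rewrite /normc /= !expr0n /= !addr0 !sqrtr_sqr.
Qed.

(** Real and imaginary parts converge by [geom_cvg]. The rate follows from [geom_telescope], whose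
    bound does not depend on k. *)
Lemma geom_ccvg (A r : R) (P : nat -> C) : 0 <= r < 1 -> 0 <= A ->
  (forall n, normc (P n.+1 - P n) <= A * r ^+ n) ->
  exists L, ccvg P L /\ forall n, normc (P n - L) <= A / (1 - r) * r ^+ n.
Proof.
move=> r01 A0 H.
have [s Ps] : exists s : R, (fun n => complex.Re (P n)) @ \oo --> s.
  apply: (geom_cvg r01 A0) => n; apply: le_trans (H n); rewrite -raddfB; exact: normc_Re.
have [t Pt] : exists t : R, (fun n => complex.Im (P n)) @ \oo --> t.
  apply: (geom_cvg r01 A0) => n; apply: le_trans (H n); rewrite -raddfB; exact: normc_Im.
have PL : ccvg P (s +i* t).
  apply: (ccvg_squeeze (b := fun n => `|complex.Re (P n) - s| + `|complex.Im (P n) - t|)).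
    by move=> n; apply: le_trans (normc_ReIm _) _; case: (P n).
  rewrite -[0 : R]addr0; apply: (@cvgD R R^o nat \oo).
    by apply/norm_cvg0P/subr_cvg0.
  by apply/norm_cvg0P/subr_cvg0.
exists (s +i* t); split=> // n; apply/ler_addgt0Pr => e e0.
move/ccvgP/cvgrPdist_lt: PL => /(_ e e0) [m _ Hm].
have := Hm (n + m)%N (leq_addl _ _); rewrite /= sub0r normrN ger0_norm ?normc_ge0 // => Hl.
apply: le_trans (ler_normcB _ (P (n + m)%N) _) _; apply: lerD; last exact: ltW.
by rewrite normcB; apply: geom_telescope.
Qed.

(** From 1 + x <= exp x, by induction with the partial sum of M r^k in the exponent. *)
Lemma prod_bound (M r : R) u : 0 <= r < 1 -> 0 <= M ->
  (forall k, normc (u k) <= M * r ^+ k) ->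
  forall n, normc (\prod_(k < n) (1 + u k)) <= expR (M / (1 - r)).
Proof.
move=> /andP [r0 r1] M0 H n; have r1' : 0 < 1 - r by lra.
suff : normc (\prod_(k < n) (1 + u k)) <= expR (M / (1 - r) * (1 - r ^+ n)).
  move/le_trans; apply; rewrite ler_expR; apply: ler_piMr; first by rewrite divr_ge0 // ltW.
  by rewrite gerBl exprn_ge0.
elim: n => [|n IH]; first by rewrite big_ord0 expr0 subrr mulr0 expR0 normc1.
rewrite big_ord_recr /= normcM.
have -> : M / (1 - r) * (1 - r ^+ n.+1) = M / (1 - r) * (1 - r ^+ n) + M * r ^+ n.
  by rewrite exprS; field; lra.
rewrite expRD; apply: ler_pM => //; rewrite ?normc_ge0 //.
apply: le_trans (le_normcD _ _) _; rewrite normc1.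
by apply: le_trans (expR_ge1Dx _); rewrite lerD2l.
Qed.

(** The rate depends on M and r alone; this gives the uniformity in x of [Eth_bound]. *)
Lemma infprod_cvg (M r : R) u : 0 <= r < 1 -> 0 <= M ->
  (forall k, normc (u k) <= M * r ^+ k) ->
  exists L, ccvg (fun n => \prod_(k < n) (1 + u k)) L /\
    forall n, normc (\prod_(k < n) (1 + u k) - L) <= expR (M / (1 - r)) * M / (1 - r) * r ^+ n.
Proof.
move=> r01 M0 H; apply: geom_ccvg => //; first by rewrite mulr_ge0 ?expR_ge0.
move=> n; rewrite big_ord_recr /= mulrDr mulr1 addrC addKr normcM -mulrA.
by apply: ler_pM => //; rewrite ?normc_ge0 //; apply: prod_bound.
Qed.

(** Dropping the first k factors replaces M by M r^k. For large k the error bound at n = 0 is below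
    1, so the limit of the tail is at distance less than 1 from the empty product 1. *)
Lemma infprod_neq0 (M r : R) u L : 0 <= r < 1 -> 0 <= M ->
  (forall k, normc (u k) <= M * r ^+ k) -> (forall k, 1 + u k != 0) ->
  ccvg (fun n => \prod_(k < n) (1 + u k)) L -> L != 0.
Proof.
move=> r01 M0 H u0 cL; have /andP [r0 r1] := r01; have r1' : 0 < 1 - r by lra.
have /cvgrPdist_lt /(_ 1 ltr01) [k _ /(_ k (leqnn _))] :=
  @cvg_geom0 (expR (M / (1 - r)) * M / (1 - r)) r r01.
rewrite /= sub0r normrN => Hk.
have M'0 : 0 <= M * r ^+ k by rewrite mulr_ge0 ?exprn_ge0.
have [|L' [cL' bL']] := @infprod_cvg (M * r ^+ k) r (fun j => u (k + j)%N) r01 M'0.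
  by move=> j; rewrite -mulrA -exprD.
have EL : L = \prod_(j < k) (1 + u j) * L'.
  apply: (@ccvg_unique (fun n => \prod_(j < k + n) (1 + u j))).
    apply/cvgrPdist_lt => e e0; move/cvgrPdist_lt: cL => /(_ e e0) [m _ Hm].
    exists m => // n /= mn; apply: Hm; apply: leq_trans mn (leq_addl _ _).
  have := ccvgM (ccvg_cst (\prod_(j < k) (1 + u j))) cL'.
  by move/ccvg_ext; apply => n; rewrite big_split_ord.
rewrite EL mulf_neq0 //; first by apply/prodf_neq0.
apply/eqP => L'0; have := bL' 0%N; rewrite big_ord0 L'0 subr0 normc1 expr0 mulr1.
apply/negP; rewrite -ltNge; apply: le_lt_trans Hk.
rewrite ger0_norm; last by rewrite mulr_ge0 ?exprn_ge0 // divr_ge0 ?mulr_ge0 ?expR_ge0 // ltW.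
rewrite [X in _ <= X]mulrAC -[X in _ <= X / _]mulrA; apply: ler_wpM2r; first by rewrite invr_ge0 ltW.
apply: ler_wpM2r => //; rewrite ler_expR; apply: ler_wpM2r; first by rewrite invr_ge0 ltW.
by rewrite ler_piMr // exprn_ile1 // ltW.
Qed.

(** * Convergence, zeros, inversion and continuity of the theta function *)

Section Eth.
Variable p : C.
Hypothesis hp : normc p < 1.
Local Notation r := (normc p).
Local Notation E := (Eth p).

Let r01 : 0 <= r < 1.
Proof. by rewrite normc_ge0. Qed.

Let ufac x k : C := (1 - x * p ^+ k) * (1 - p ^+ k.+1 / x) - 1.

Let theta_partialE x n : theta_partial p x n = \prod_(k < n) (1 + ufac x k).
Proof. by apply: eq_bigr => k _; rewrite [RHS]addrC subrK. Qed.

Let ufac_bound (X : R) x : x != 0 -> 0 <= X -> normc x <= X -> normc x^-1 <= X ->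
  forall k, normc (ufac x k) <= (X + X + 1) * r ^+ k.
Proof.
move=> x0 X0 xX xX' k; have /andP [r0 r1] := r01.
have -> : ufac x k = - (x * p ^+ k) - p ^+ k.+1 / x + p ^+ k * p ^+ k.+1.
  by rewrite /ufac; field.
apply: le_trans (le_normcD _ _) _; rewrite 2!mulrDl mul1r; apply: lerD; last first.
  by rewrite normcM !normcX ler_piMr ?exprn_ge0 // exprn_ile1 // ltW.
apply: le_trans (le_normcD _ _) _; rewrite !normcN !normcM !normcX; apply: lerD.
  by apply: ler_wpM2r => //; rewrite exprn_ge0.
rewrite mulrC; apply: ler_pM; rewrite ?normc_ge0 ?exprn_ge0 //.
by rewrite exprS ler_piMl ?exprn_ge0 // ltW.
Qed.

(** One constant serves a whole annulus, as [Eth_continuous] requires. *)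
Lemma Eth_bound (X : R) : 0 <= X -> exists B : R, forall x, x != 0 ->
  normc x <= X -> normc x^-1 <= X ->
  ccvg (theta_partial p x) (E x) /\ forall n, normc (theta_partial p x n - E x) <= B * r ^+ n.
Proof.
move=> X0; pose M := X + X + 1; have M0 : 0 <= M by rewrite /M; lra.
exists (expR (M / (1 - r)) * M / (1 - r)) => x x0 xX xX'.
have [L [cL bL]] := infprod_cvg r01 M0 (ufac_bound x0 X0 xX xX').
have cL' : ccvg (theta_partial p x) L by apply: (ccvg_ext cL) => n; rewrite theta_partialE.
have EL : E x = L by exact: (@norm_cvg_lim C C^o (theta_partial p x @ \oo) _ L cL').
by rewrite EL; split=> // n; rewrite theta_partialE.
Qed.

Lemma Eth_cvg x : x != 0 -> ccvg (theta_partial p x) (E x).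
Proof.
move=> x0; have [|B /(_ x x0)] := @Eth_bound (normc x + normc x^-1).
  by rewrite addr_ge0 ?normc_ge0.
by rewrite lerDl lerDr !normc_ge0 => /(_ isT isT) [].
Qed.

Lemma Eth_eq0 x : x != 0 -> E x = 0 -> exists k, x * p ^+ k = 1 \/ x = p ^+ k.+1.
Proof.
move=> x0 /eqP; apply: contraTP => H.
have X0 : 0 <= normc x + normc x^-1 by rewrite addr_ge0 ?normc_ge0.
have M0 : 0 <= (normc x + normc x^-1) + (normc x + normc x^-1) + 1 by lra.
apply: (infprod_neq0 r01 M0 (ufac_bound x0 X0 _ _)).
- by rewrite lerDl normc_ge0.
- by rewrite lerDr normc_ge0.
- move=> k; rewrite [X in X != 0]addrC subrK mulf_neq0 //.
    by rewrite subr_eq0; apply/eqP => e; apply: H; exists k; left.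
  rewrite subr_eq0; apply/eqP => e; apply: H; exists k; right.
  by rewrite -[p ^+ _](divfK x0) -e mul1r.
- by apply: (ccvg_ext (Eth_cvg x0)) => n; rewrite theta_partialE.
Qed.

Lemma Eth1 : E 1 = 0.
Proof.
apply: (ccvg_unique (Eth_cvg (oner_neq0 _))).
apply/cvgrPdist_lt => e e0; exists 1%N => // n /= n0.
rewrite /theta_partial -(prednK n0) big_ord_recl expr0 mulr1 subrr !mul0r subrr normr0 //.
Qed.

Lemma ccvg_expp : ccvg (fun n => p ^+ n) 0.
Proof.
apply: (ccvg_squeeze (b := fun n => 1 * r ^+ n)); last exact: cvg_geom0.
by move=> n; rewrite subr0 normcX mul1r.
Qed.

(** It holds for partial products up to the boundary factors 1 - p^n/x and 1 - x p^n, which tend to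
    1. *)
Lemma Eth_inv x : x != 0 -> E x^-1 = - (E x / x).
Proof.
move=> x0; have x0' : x^-1 != 0 by rewrite invr_eq0.
suff : E x^-1 * (1 - 0 / x) * x = - (E x * (1 - x * 0)).
  rewrite mul0r mulr0 subr0 !mulr1 => H.
  by rewrite -[LHS](mulfK x0) H mulNr.
have T n : theta_partial p x^-1 n * (1 - p ^+ n / x) * x =
    - (theta_partial p x n * (1 - x * p ^+ n)).
  elim: n => [|n IH].
    by rewrite /theta_partial !big_ord0 expr0; field.
  rewrite /theta_partial !big_ord_recr /= -/(theta_partial _ _ _) -/(theta_partial _ _ _).
  rewrite invrK.
  transitivity (theta_partial p x^-1 n * (1 - p ^+ n / x) * x * ((1 - p ^+ n.+1 * x) * (1 - p ^+ n.+1 / x))).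
    by rewrite [x^-1 * _]mulrC; ring.
  rewrite IH; ring.
have c1 y : ccvg (fun n => 1 - p ^+ n * y) (1 - 0 * y).
  exact: ccvgD (ccvg_cst 1) (ccvgN (ccvgM ccvg_expp (ccvg_cst y))).
have c2 : ccvg (fun n => 1 - x * p ^+ n) (1 - x * 0).
  exact: ccvgD (ccvg_cst 1) (ccvgN (ccvgM (ccvg_cst x) ccvg_expp)).
apply: (@ccvg_unique (fun n => - (theta_partial p x n * (1 - x * p ^+ n)))); last first.
  exact: ccvgN (ccvgM (Eth_cvg x0) c2).
apply: (ccvg_ext (ccvgM (ccvgM (Eth_cvg x0') (c1 x^-1)) (ccvg_cst x))) => n; exact: T.
Qed.

(** A uniform limit of continuous partial products, in three parts of size e/3. The summand 1 in [X]
    leaves room for [u n] and its inverse to lie eventually in the annulus. *)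
Lemma Eth_continuous u x : x != 0 -> (forall n, u n != 0) -> ccvg u x ->
  ccvg (fun n => E (u n)) (E x).
Proof.
move=> x0 u0 ux.
pose X := normc x + normc x^-1 + 1.
have x1 := normc_ge0 x; have x2 := normc_ge0 x^-1.
have [|B HB] := @Eth_bound X; first by rewrite /X; lra.
have [_ bx] : ccvg (theta_partial p x) (E x) /\ forall n, normc (theta_partial p x n - E x) <= B * r ^+ n.
  by apply: HB => //; rewrite /X; lra.
have near_le v l : ccvg v l -> \forall n \near \oo, normc (v n) <= normc l + 1.
  move=> /ccvgP/cvgrPdist_lt /(_ 1 ltr01); apply: filterS => n.
  rewrite sub0r normrN ger0_norm ?normc_ge0 // => H.
  rewrite -[v n](subrK l) addrC; apply: le_trans (le_normcD _ _) _; rewrite lerD2l.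
  by rewrite ltW // -[X in _ < X]add0r.
apply/ccvgP/cvgrPdist_le => e e0.
have e3 : 0 < e / 3 by rewrite divr_gt0.
have /cvgrPdist_lt /(_ _ e3) [k _ /(_ k (leqnn _))] := @cvg_geom0 B r r01.
rewrite /= sub0r normrN => Bk.
have cT : ccvg (fun n => theta_partial p (u n) k) (theta_partial p x k).
  apply: ccvg_prod => j.
  exact: ccvgM (ccvgD (ccvg_cst 1) (ccvgN (ccvgM ux (ccvg_cst _))))
    (ccvgD (ccvg_cst 1) (ccvgN (ccvgM (ccvg_cst _) (ccvgV x0 ux)))).
near=> n.
rewrite sub0r normrN ger0_norm ?normc_ge0 //.
have un : normc (u n) <= X.
  apply: (@le_trans _ _ (normc x + 1)); last by rewrite /X; lra.
  by near: n; exact: near_le ux.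
have un' : normc (u n)^-1 <= X.
  apply: (@le_trans _ _ (normc x^-1 + 1)); last by rewrite /X; lra.
  by near: n; exact: near_le (ccvgV x0 ux).
have [_ bu] := HB (u n) (u0 n) un un'.
have Tn : normc (theta_partial p (u n) k - theta_partial p x k) <= e / 3.
  rewrite -[X in X <= _]ger0_norm ?normc_ge0 // -normrN -sub0r ltW //.
  by near: n; exact: (iffLR (cvgrPdist_lt _ _) (iffLR (ccvgP _ _) cT) _ e3).
have := ler_norm (B * r ^+ k); have := bu k; have := bx k.
have := ler_normcB (E (u n)) (theta_partial p (u n) k) (E x).
have := ler_normcB (theta_partial p (u n) k) (theta_partial p x k) (E x).
rewrite (normcB (E (u n)) (theta_partial p (u n) k)); move: Bk Tn; lra.
Unshelve. all: by end_near. Qed.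

End Eth.

End ComplexSequences.
Arguments ccvg_cst {R} l.

(** * Jacobi triple product and Pluecker relation *)

Section TripleProduct.
Variables (R : realType) (p w0 : R[i]).
Local Notation C := R[i].
Hypothesis hp : normc p < 1.
Hypothesis p0 : p != 0.
Hypothesis w0p : w0 ^+ 2 = p.

Definition pfac n : C := \prod_(i < n) (1 - p ^+ i.+1).
(** The Gaussian binomial coefficient in base p, set to 0 beyond j = M so that Pascal's rule holds
    at the boundary. *)
Definition gbin M j : C := if (j <= M)%N then pfac M / (pfac j * pfac (M - j)) else 0.

Lemma w0_neq0 : w0 != 0.
Proof. by apply: contra_neq p0; rewrite -w0p => ->; rewrite expr0n. Qed.

Lemma pfacS n : pfac n.+1 = pfac n * (1 - p ^+ n.+1).
Proof. by rewrite /pfac big_ord_recr. Qed.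

Lemma subr1p_neq0 n : 1 - p ^+ n.+1 != 0.
Proof.
rewrite subr_eq0; apply/eqP => H; have := exprn_ilt1 n.+1 (normc_ge0 p) hp.
by rewrite -normcX -H normc1 ltxx.
Qed.

Lemma pfac_neq0 n : pfac n != 0.
Proof. by apply/prodf_neq0 => i _; apply: subr1p_neq0. Qed.

Lemma gbin0 M : gbin M 0 = 1.
Proof. by rewrite /gbin /= subn0 /pfac big_ord0 mul1r divff // pfac_neq0. Qed.

(** Multiplied through by p^j, which turns the usual p^(M-j) into p^M. *)
Lemma gbin_pascal M j : (j <= M)%N ->
  p ^+ j * gbin M.+1 j.+1 = p ^+ j * gbin M j.+1 + p ^+ M * gbin M j.
Proof.
move=> jM; rewrite /gbin ltnS jM subSS; case: ltngtP jM => // [jM|<-] _.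
  have [k ->] : exists k, M = (j + k.+1)%N by exists (M - j.+1)%N; lia.
  rewrite addKn (_ : (j + k.+1 - j.+1)%N = k); last by lia.
  rewrite addnS !pfacS !exprS !exprD.
  have := pfac_neq0 j; have := pfac_neq0 k; have := subr1p_neq0 j; have := subr1p_neq0 k.
  by rewrite !exprS => *; field; do ! (apply/andP; split).
rewrite subnn pfacS /pfac big_ord0 !mulr1 mulr0 add0r.
have := pfac_neq0 j; have := subr1p_neq0 j; rewrite /pfac => *.
by field; apply/andP.
Qed.

(** The finite q-binomial theorem. The extra [w0], a square root of p, makes the exponent the pure
    square j^2 in base w0. *)
Lemma gauss_binomial M (y : C) :
  \prod_(k < M) (1 + y * w0 * p ^+ k) = \sum_(j < M.+1) gbin M j * w0 ^+ (j * j) * y ^+ j.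
Proof.
elim: M => [|M IH]; first by rewrite big_ord0 big_ord1 gbin0 !mulr1.
pose c j := gbin M j * w0 ^+ (j * j) * y ^+ j.
have step j : (j < M.+1)%N -> gbin M.+1 j.+1 * w0 ^+ (j.+1 * j.+1) * y ^+ j.+1 =
    c j.+1 + y * w0 * p ^+ M * c j.
  move=> jM; have wE : w0 ^+ (j.+1 * j.+1) = p ^+ j * w0 * w0 ^+ (j * j).
    rewrite -w0p -exprM -exprSr -exprD; congr (_ ^+ _); lia.
  rewrite /c !wE exprS.
  transitivity ((p ^+ j * gbin M.+1 j.+1) * w0 * w0 ^+ (j * j) * (y * y ^+ j)); first by ring.
  rewrite gbin_pascal //; ring.
rewrite big_ord_recr /= IH big_ord_recl [RHS]big_ord_recl /=.
rewrite [in RHS](eq_bigr (fun j : 'I_M.+1 => c j.+1 + y * w0 * p ^+ M * c j)); last first.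
  by move=> j _; apply: step.
rewrite big_split /= -big_distrr /= big_ord_recr /= big_ord_recl /=.
have -> : c M.+1 = 0 by rewrite /c /gbin ltnn !mul0r.
have -> : c 0%N = gbin M.+1 0%N * w0 ^+ (0 * 0) * y ^+ 0 by rewrite /c !gbin0.
have -> : gbin M 0%N * w0 ^+ (0 * 0) * y ^+ 0 = gbin M.+1 0%N * w0 ^+ (0 * 0) * y ^+ 0.
  by rewrite !gbin0.
rewrite -/(c _); under eq_bigr do rewrite -/(c _).
ring.
Qed.

Definition tterm (w : C) (m : int) : C := w0 ^ (m * m) * w ^ m.

(** The finite Jacobi triple product: [gauss_binomial] with 2N factors, centred by the shift p^(-N).
    The first N factors, reversed, are the factors 1 - p^(k+1)/x up to monomials. *)
Lemma triple_product x N : x != 0 -> theta_partial p x N =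
  \sum_(j < N.*2.+1) gbin N.*2 j * tterm (- x / w0) (j%:Z - N%:Z).
Proof.
move=> x0; set w := - x / w0; have v0 := w0_neq0.
have w1 : w != 0 by rewrite mulf_neq0 ?oppr_eq0 ?invr_eq0.
have E := gauss_binomial N.*2 (w / p ^+ N).
have Ex k : 1 + w / p ^+ N * w0 * p ^+ k = 1 - x / p ^+ N * p ^+ k.
  by rewrite /w; congr (1 + _); field; rewrite v0 expf_neq0.
rewrite -addnn big_split_ord /= in E.
rewrite [X in _ * X](eq_bigr (fun k : 'I_N => 1 - x * p ^+ k)) in E; last first.
  by move=> k _; rewrite Ex exprD; field; rewrite expf_neq0.
rewrite (reindex_inj rev_ord_inj) /= in E.
rewrite [X in X * _](eq_bigr (fun k : 'I_N => (w / w0 ^+ k.*2.+1) * (1 - p ^+ k.+1 / x))) in E; last first.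
  move=> k _; rewrite Ex.
  have -> : p ^+ N = p ^+ (N - k.+1) * p ^+ k.+1 by rewrite -exprD subnK.
  have -> : w / w0 ^+ k.*2.+1 = - x / p ^+ k.+1.
    rewrite /w -w0p -exprM; have -> : w0 ^+ (2 * k.+1) = w0 * w0 ^+ k.*2.+1.
      by rewrite -exprS; congr (_ ^+ _); lia.
    by field; rewrite v0 expf_neq0.
  by field; rewrite x0 !expf_neq0.
rewrite big_split /= in E.
have Ew : \prod_(k < N) (w / w0 ^+ k.*2.+1) = w ^+ N / w0 ^+ (N * N).
  clear E Ex; elim: N => [|N IH]; first by rewrite big_ord0 !expr0 divr1.
  rewrite big_ord_recr /= IH.
  have -> : (N.+1 * N.+1 = N * N + N.*2.+1)%N by lia.
  by rewrite exprD [w ^+ N.+1]exprS; field; rewrite !expf_neq0.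
rewrite Ew in E.
have nz : w ^+ N / w0 ^+ (N * N) != 0 by rewrite mulf_neq0 ?invr_eq0 ?expf_neq0.
apply: (mulfI nz); rewrite /theta_partial big_split /= [X in _ * X]mulrC mulrA E.
rewrite big_distrr /= addnn; apply: eq_bigr => j _.
rewrite /tterm expfzDr // -exprnP -invr_expz -exprnP.
have -> : w0 ^ ((j%:Z - N%:Z) * (j%:Z - N%:Z)) =
    w0 ^+ (j * j) * w0 ^+ (N * N) / (p ^+ N) ^+ j.
  have -> : (j%:Z - N%:Z) * (j%:Z - N%:Z) = (j * j)%N%:Z + (N * N)%N%:Z - (2 * N * j)%N%:Z.
    by rewrite !PoszM; ring.
  by rewrite !expfzDr // -invr_expz -!exprnP -w0p -!exprM mulnA.
by rewrite expr_div_n; field; rewrite !expf_neq0.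
Qed.


(** A sum over [-N, N], grouped so that passing from N to N + 1 appends one summand. *)
Definition zsum (V : nmodType) N (f : int -> V) : V :=
  f 0 + \sum_(k < N) (f k.+1%:Z + f (- k.+1%:Z)).

Lemma zsumE (V : nmodType) N (f : int -> V) :
  \sum_(j < N.*2.+1) f (j%:Z - N%:Z) = zsum N f.
Proof.
rewrite -addnn -addnS big_split_ord /= (reindex_inj rev_ord_inj) /= big_ord_recl /zsum.
rewrite addn0 subrr addrCA big_split /=; congr (_ + _); rewrite addrC; congr (_ + _).
  by apply: eq_bigr => k _; congr f; rewrite /bump /= PoszD; ring.
by apply: eq_bigr => k _; congr f; rewrite -subzn //; ring.
Qed.

(** The term is (s^k Y)^k, at most 1 once s^k Y < 1; the finitely many earlier terms are added to
    the bound. *)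
Lemma superexp_bound (s Y : R) : 0 <= s < 1 -> 0 <= Y ->
  exists2 B : R, 0 <= B & forall k, s ^+ (k * k) * Y ^+ k <= B.
Proof.
move=> s01 Y0; have /andP [s0 s1] := s01.
have /cvgrPdist_lt /(_ 1 ltr01) [K _ HK] := @cvg_geom0 R Y s s01.
have t0 k : 0 <= s ^+ (k * k) * Y ^+ k by rewrite mulr_ge0 ?exprn_ge0.
exists (1 + \sum_(k < K) s ^+ (k * k) * Y ^+ k); first by rewrite addr_ge0 ?sumr_ge0.
move=> k; have [Kk|kK] := leqP K k.
  apply: (@le_trans _ _ 1); last by rewrite lerDl sumr_ge0.
  rewrite exprM -exprMn; apply: exprn_ile1; first by rewrite mulr_ge0 ?exprn_ge0.
  have := HK k Kk; rewrite /= sub0r normrN ger0_norm ?mulr_ge0 ?exprn_ge0 // mulrC.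
  exact: ltW.
rewrite (bigD1 (Ordinal kK)) //= addrCA lerDl addr_ge0 ?ler01 //.
by apply: sumr_ge0.
Qed.

Lemma normc_w0 : 0 < normc w0 < 1.
Proof.
rewrite lt_def normc_eq0 w0_neq0 normc_ge0 /=.
by have := hp; rewrite -w0p normcX expr_lt1 ?normc_ge0.
Qed.

Lemma normcXz (x : C) (m : int) : normc (x ^ m) = normc x ^ m.
Proof.
by case: m => m; rewrite ?NegzE -?invr_expz ?normcV -!exprnP normcX.
Qed.

Lemma normc_p_gt0 : 0 < normc p.
Proof. by rewrite lt_def normc_eq0 p0 normc_ge0. Qed.

(** The ratio |p|/2 is made for [Eth_series]: against the error |p|^(N-|m|) it leaves |p|^N / 2^|m|,
    summable in m and tending to 0 in N. The factor w0^(m*m) allows any positive ratio. *)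
Lemma tterm_bound (w : C) : w != 0 ->
  exists2 B : R, 0 <= B & forall m, normc (tterm w m) <= B * (normc p / 2) ^+ `|m|%N.
Proof.
move=> w1; pose X := normc w + normc w^-1.
have X0 : 0 <= X by rewrite addr_ge0 ?normc_ge0.
have r2 : 0 < normc p / 2 by rewrite divr_gt0 // normc_p_gt0.
have /andP [s0 s1] := normc_w0.
have [||B B0 HB] := @superexp_bound (normc w0) (X / (normc p / 2)).
- by rewrite s1 ltW.
- by rewrite divr_ge0 // ltW.
exists B => // m; have := HB `|m|%N.
rewrite expr_div_n mulrA ler_pdivrMr ?exprn_gt0 //; apply: le_trans.
rewrite /tterm normcM !normcXz; apply: ler_pM; rewrite ?exprz_ge0 ?normc_ge0 //.
  by rewrite [X in _ <= X]exprnP PoszM; case: m => m //; rewrite NegzE mulrNN.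
case: m => m; rewrite ?NegzE /= -?exprnP.
  by rewrite lerXn2r ?nnegrE ?normc_ge0 // /X lerDl normc_ge0.
rewrite -invr_expz -exprnP -exprVn -normcV lerXn2r ?nnegrE ?normc_ge0 //.
by rewrite /X lerDr normc_ge0.
Qed.

Lemma ccvg_bounded (u : nat -> C) l : ccvg u l -> exists D : R, forall n, normc (u n) <= D.
Proof.
move=> /ccvgP/cvgrPdist_lt /(_ 1 ltr01) [K _ HK].
exists (normc l + 1 + \sum_(k < K) normc (u k)) => n; have [Kn|nK] := leqP K n.
  have := HK n Kn; rewrite /= sub0r normrN ger0_norm ?normc_ge0 // => /ltW H.
  apply: (@le_trans _ _ (normc l + 1)); last by rewrite lerDl sumr_ge0 // => *; apply: normc_ge0.
  by rewrite -[u n](subrK l) addrC; apply: le_trans (le_normcD _ _) _; rewrite lerD2l.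
rewrite (bigD1 (Ordinal nK)) //= addrCA lerDl !addr_ge0 ?normc_ge0 ?ler01 //.
by apply: sumr_ge0 => *; apply: normc_ge0.
Qed.

Lemma zsum_half N : zsum N (fun m => (2^-1 : R) ^+ `|m|%N) <= 3.
Proof.
suff : zsum N (fun m => (2^-1 : R) ^+ `|m|%N) = 3 - 2 * 2^-1 ^+ N.
  by move=> ->; rewrite gerBl mulr_ge0 ?exprn_ge0 ?invr_ge0.
elim: N => [|N IH]; first by rewrite /zsum big_ord0 /= !expr0; lra.
rewrite /zsum big_ord_recr /= addrA -/(zsum N (fun m => (2^-1 : R) ^+ `|m|%N)) IH /= exprS.
by field.
Qed.

Lemma pfac_limit : exists k : C, [/\ k != 0, ccvg pfac k &
  exists A : R, forall n, normc (pfac n - k) <= A * normc p ^+ n].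
Proof.
have r01 : 0 <= normc p < 1 by rewrite normc_ge0.
have Hu k : normc (- p ^+ k.+1) <= 1 * normc p ^+ k.
  rewrite normcN normcX exprS; apply: ler_wpM2r; last exact: ltW.
  by rewrite exprn_ge0 ?normc_ge0.
have [L [cL bL]] := infprod_cvg r01 ler01 Hu.
exists L; split => //; last by eexists; exact: bL.
by apply: (infprod_neq0 r01 ler01 Hu) => // k; apply: subr1p_neq0.
Qed.

Lemma gbin_index N (m : int) : (`|m| <= N)%N -> let j := `|(N%:Z + m)%R|%N in
  [/\ (j <= N.*2)%N, (N - `|m| <= N.*2)%N, (N - `|m| <= j)%N & (N - `|m| <= N.*2 - j)%N].
Proof. by move=> mN /=; split; lia. Qed.

Lemma gbin_shift N (j : 'I_N.*2.+1) :
  (`|(j%:Z - N%:Z)%R| <= N)%N /\ `|(N%:Z + (j%:Z - N%:Z))%R|%N = j.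
Proof. by have := leq_ord j => jN; split; lia. Qed.

(** With [k] the limit of [pfac], the coefficient k * gbin(2N, N+m) is 1 up to a multiple of
    |p|^(N-|m|). Hence the finite triple product, times [k], and the truncated theta series have the
    same limit. *)
Lemma Eth_series : exists2 k : C, k != 0 & forall x : C, x != 0 ->
  ccvg (fun N => zsum N (tterm (- x / w0))) (k * Eth p x).
Proof.
have [k [k0 ck [A HA]]] := pfac_limit; exists k; first exact: k0.
move=> x x0.
have [D HD] := ccvg_bounded ck.
have [D' HD'] := ccvg_bounded (ccvgV k0 ck).
have [|B B0 HB] := @tterm_bound (- x / w0).
  by rewrite mulf_neq0 ?oppr_eq0 ?invr_eq0 ?w0_neq0.
set w := - x / w0 in HB *.
have r01 : 0 <= normc p < 1 by rewrite normc_ge0.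
have /andP [r0 r1] := r01.
have D0 : 0 <= D by apply: le_trans (HD 0%N); apply: normc_ge0.
have D'0 : 0 <= D' by apply: le_trans (HD' 0%N); apply: normc_ge0.
have A0 : 0 <= A by have := HA 0%N; rewrite expr0 mulr1; apply: le_trans; apply: normc_ge0.
pose A' := (normc k * A + normc k * A + D * A) * (D' * D').
have A'0 : 0 <= A' by rewrite !(mulr_ge0, addr_ge0) // normc_ge0.
have gb N (m : int) : (`|m| <= N)%N ->
    normc (k * gbin N.*2 `|(N%:Z + m)%R|%N - 1) <= A' * normc p ^+ (N - `|m|).
  move=> mN; have [] := gbin_index mN; set j := `|_|%N => j2 l1 l2 l3.
  have le1 i : (N - `|m| <= i)%N -> normc (pfac i - k) <= A * normc p ^+ (N - `|m|).
    move=> li; apply: le_trans (HA i) _; apply: ler_wpM2l => //.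
    by apply: ler_wiXn2l => //; exact: ltW.
  (* The difference k pfac(2N) - pfac(j) pfac(2N-j), telescoped so that each term contains one error
     of [pfac]. *)
  rewrite /gbin j2 (_ : _ - 1 = (k * (pfac N.*2 - k) + k * (k - pfac j) +
     pfac j * (k - pfac (N.*2 - j))) * ((pfac j)^-1 * (pfac (N.*2 - j))^-1)); last first.
    by field; rewrite !pfac_neq0.
  rewrite normcM [A' * _]mulrAC; apply: ler_pM; rewrite ?normc_ge0 //; last first.
    by rewrite normcM; apply: ler_pM; rewrite ?normc_ge0.
  rewrite !mulrDl -!mulrA; apply: le_trans (le_normcD _ _) _; apply: lerD.
    apply: le_trans (le_normcD _ _) _; rewrite !normcM; apply: lerD.
      by apply: ler_wpM2l; rewrite ?normc_ge0 // le1.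
    by apply: ler_wpM2l; rewrite ?normc_ge0 // normcB le1.
  by rewrite normcM; apply: ler_pM; rewrite ?normc_ge0 // normcB le1.
have TN N : k * theta_partial p x N = zsum N (fun m => k * gbin N.*2 `|(N%:Z + m)%R|%N * tterm w m).
  rewrite triple_product // -zsumE big_distrr /=; apply: eq_bigr => j _.
  by rewrite mulrA -/w; have [_ ->] := gbin_shift j.
have cT : ccvg (fun N => k * theta_partial p x N) (k * Eth p x).
  exact: ccvgM (ccvg_cst k) (Eth_cvg hp x0).
have c0 : ccvg (fun N => zsum N (tterm w) - k * theta_partial p x N) 0.
  apply: (ccvg_squeeze (b := fun N => (A' * B * 3) * normc p ^+ N)); last exact: cvg_geom0.
  move=> N; rewrite subr0 TN -!zsumE -sumrB.
  apply: le_trans (normc_sum _ _ _) _.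
  apply: (@le_trans _ _ (\sum_(j < N.*2.+1) A' * B * normc p ^+ N * (2^-1 : R) ^+ `|(j%:Z - N%:Z)%R|%N)).
    apply: ler_sum => j _; have [] := gbin_shift j; set m := j%:Z - N%:Z => mN _.
    rewrite -{1}[tterm w m]mul1r -mulrBl normcM normcB.
    apply: le_trans (ler_pM _ _ (gb N m mN) (HB m)) _; rewrite ?normc_ge0 //.
    rewrite expr_div_n -exprVn le_eqVlt; apply/orP; left; apply/eqP.
    by rewrite -{2}(subnK mN) exprD; ring.
  rewrite -big_distrr /= (zsumE N (fun m => (2^-1 : R) ^+ `|m|%N)).
  rewrite (mulrAC (A' * B) 3); apply: ler_wpM2l; last exact: zsum_half.
  by apply: mulr_ge0; [exact: mulr_ge0 | exact: exprn_ge0].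
have := ccvgD c0 cT; rewrite add0r => /ccvg_ext; apply => N; exact: subrK.
Qed.

(** * Products of two theta series, summed over squares and diamonds *)

Definition zr N : seq int := [seq (j%:Z - N%:Z) | j <- index_iota 0 N.*2.+1].

Lemma sum_zr (V : nmodType) N (f : int -> V) : \sum_(m <- zr N) f m = zsum N f.
Proof. by rewrite big_map big_mkord zsumE. Qed.

Lemma mem_zr N m : (m \in zr N) = (`|m| <= N)%N.
Proof.
apply/mapP/idP => [[j]|mN]; first by rewrite mem_index_iota => jN ->; lia.
by exists `|(m + N%:Z)%R|%N; [rewrite mem_index_iota; lia | lia].
Qed.

Lemma uniq_zr N : uniq (zr N).
Proof. by rewrite map_inj_uniq ?iota_uniq // => i j; lia. Qed.

Lemma sum_subset (T : eqType) (V : nmodType) (a : T -> V) s t : uniq s -> uniq t ->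
  {subset s <= t} -> \sum_(x <- s) a x = \sum_(x <- t | x \in s) a x.
Proof.
move=> us ut st; rewrite -[RHS]big_filter; apply: perm_big; apply: uniq_perm => //.
  exact: filter_uniq.
by move=> x; rewrite mem_filter; case xs: (x \in s) => //=; rewrite st.
Qed.

(** For comparing two exhaustions of the plane lattice: the difference involves only indices in [s3]
    outside [s1], where absolute values are summed. *)
Lemma region_bound (T : eqType) (a : T -> C) s1 s2 s3 :
  uniq s1 -> uniq s2 -> uniq s3 -> {subset s1 <= s2} -> {subset s2 <= s3} ->
  normc (\sum_(x <- s2) a x - \sum_(x <- s1) a x) <=
  \sum_(x <- s3) normc (a x) - \sum_(x <- s1) normc (a x).
Proof.
move=> u1 u2 u3 s12 s23; have s13 : {subset s1 <= s3} by move=> x /s12 /s23.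
rewrite (sum_subset a u2 u3 s23) (sum_subset a u1 u3 s13) (sum_subset _ u1 u3 s13).
rewrite [X in _ <= X - _](bigID (fun x => x \in s1)) /= addrAC subrr add0r.
rewrite (bigID (fun x => x \in s1)) /=.
rewrite (eq_bigl (fun x => x \in s1)); last first.
  by move=> x; case xs: (x \in s1); rewrite ?andbF // andbT s12.
rewrite addrAC subrr add0r; apply: le_trans (normc_sum _ _ _) _.
rewrite big_mkcond [leRHS]big_mkcond /=; apply: ler_sum => x _.
by case: (x \in s1) => /=; case: (x \in s2) => //=; rewrite normc_ge0.
Qed.

(** In terms of p, the sums of p^(i^2-i) x^(2i) here and of p^(i^2) x^(2i+1) in [gser]: the two
    parity classes of m + n in the product of the series for E(xy) and E(x/y). *)
Definition fser N (x : C) : C := \sum_(i <- zr N) w0 ^ (2 * i * i - 2 * i) * x ^ (2 * i).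
Definition gser N (x : C) : C := \sum_(i <- zr N) w0 ^ (2 * i * i) * x ^ (2 * i + 1).
(** The index pairs (m, n) reached when the partial sums of [fser] and [gser] are multiplied. *)
Definition diamond N : seq (int * int) :=
  [seq (i + j, i - j) | i <- zr N, j <- zr N] ++
  [seq (i + j, i - j + 1) | i <- zr N, j <- zr N].
Definition square N : seq (int * int) := [seq (i, j) | i <- zr N, j <- zr N].

Lemma uniq_square N : uniq (square N).
Proof. by apply: allpairs_uniq; rewrite ?uniq_zr // => -[i j] [k l]. Qed.

Lemma uniq_diamond N : uniq (diamond N).
Proof.
rewrite cat_uniq; apply/and3P; split.
- apply: allpairs_uniq; rewrite ?uniq_zr // => -[i j] [k l] _ _ [] /= e1 e2.
  by congr (_, _); lia.
- apply/hasPn => z /allpairsP [[i j] [_ _ ->]].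
  apply/negP => /allpairsP [[k l]]; rewrite /= => -[_ _ e].
  by case: e; lia.
- apply: allpairs_uniq; rewrite ?uniq_zr // => -[i j] [k l] _ _ [] /= e1 e2.
  by congr (_, _); lia.
Qed.

Lemma square_sub_diamond N : {subset square N <= diamond N}.
Proof.
move=> z /allpairsP [[m n] [/=]]; rewrite !mem_zr => mN nN ->.
rewrite mem_cat; apply/orP.
have : (exists i, m + n = 2 * i) \/ (exists i, m + n = 2 * i + 1).
  have := divz_eq (m + n) 2; have := modz_ge0 (m + n) (isT : (2 : int) != 0).
  have := ltz_pmod (m + n) (isT : (0 : int) < 2).
  move: (modz _ _) (divz _ _) => r d r2 r0 e.
  by have [r1|r1] : r = 0 \/ r = 1 by [lia]; [left|right]; exists d; lia.
case=> -[i e]; [left | right]; apply/allpairsP.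
  by exists (i, m - i); rewrite !mem_zr /=; split; [lia|lia|congr (_, _); lia].
by exists (i, m - i); rewrite !mem_zr /=; split; [lia|lia|congr (_, _); lia].
Qed.

Lemma diamond_sub_square N : {subset diamond N <= square N.*2.+1}.
Proof.
move=> z; rewrite mem_cat => /orP [] /allpairsP [[i j] [/=]]; rewrite !mem_zr => iN jN ->;
  by apply: allpairs_f; rewrite mem_zr; lia.
Qed.

Lemma sum_square (w1 w2 : C) N :
  \sum_(z <- square N) tterm w1 z.1 * tterm w2 z.2 = zsum N (tterm w1) * zsum N (tterm w2).
Proof.
rewrite big_allpairs -!sum_zr big_distrl /=; apply: eq_bigr => i _.
by rewrite big_distrr.
Qed.

Lemma sum_square_normc (w1 w2 : C) N :
  \sum_(z <- square N) normc (tterm w1 z.1 * tterm w2 z.2) =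
  zsum N (fun m => normc (tterm w1 m)) * zsum N (fun m => normc (tterm w2 m)).
Proof.
rewrite big_allpairs -!sum_zr big_distrl /=; apply: eq_bigr => i _.
by rewrite big_distrr; apply: eq_bigr => j _; rewrite normcM.
Qed.

(* The substitutions [m = i + j], [n = i - j] or [i - j + 1] split the double series
   according to the parity of [m + n]. *)
Lemma sum_diamond N (x y : C) : x != 0 -> y != 0 ->
  y * \sum_(z <- diamond N) tterm (- (x * y) / w0) z.1 * tterm (- (x / y) / w0) z.2 =
  fser N x * gser N y - gser N x * fser N y.
Proof.
move=> x0 y0; have v0 := w0_neq0.
have tE (t : C) m n : t != 0 ->
    tterm (t * y) m * tterm (t * y^-1) n = w0 ^ (m * m + n * n) * t ^ (m + n) * y ^ (m - n).
  move=> t0; rewrite /tterm !expfzMl exprz_inv (expfzDr _ _ v0) (expfzDr _ _ t0) (expfzDr _ _ y0).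
  ring.
pose u := - x / w0; have u0 : u != 0 by rewrite mulf_neq0 ?oppr_eq0 ?invr_eq0.
have -> : - (x * y) / w0 = u * y by rewrite /u; field.
have -> : - (x / y) / w0 = u * y^-1 by rewrite /u; field; rewrite v0 y0.
have uE i : u ^ (2 * i) = x ^ (2 * i) * w0 ^ (- (2 * i)).
  rewrite -exprz_inv -expfzMl -!exprz_exp; congr (_ ^ i).
  by rewrite /u -!exprnP !expr2; field.
rewrite big_cat !big_allpairs_dep /= mulrDr; congr (_ + _).
  rewrite mulr_sumr /fser big_distrl /=; apply: eq_bigr => i _.
  rewrite mulr_sumr /gser big_distrr /=; apply: eq_bigr => j _.
  rewrite (tE _ _ _ u0).
  have -> : (i + j) * (i + j) + (i - j) * (i - j) = (2 * i * i - 2 * i) + 2 * j * j + 2 * i by ring.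
  have -> : i + j + (i - j) = 2 * i by ring.
  have -> : i + j - (i - j) = 2 * j by ring.
  rewrite uE !(expfzDr _ _ v0) (expfzDr _ _ y0) expr1z -!invr_expz; field.
  by rewrite !expfz_neq0.
rewrite -mulNr mulr_sumr /gser -sumrN big_distrl /=; apply: eq_bigr => i _.
rewrite mulr_sumr /fser big_distrr /=; apply: eq_bigr => j _.
rewrite (tE _ _ _ u0).
have -> : (i + j) * (i + j) + (i - j + 1) * (i - j + 1) =
  2 * i * i + (2 * j * j - 2 * j) + 2 * i + 1 by ring.
have -> : i + j + (i - j + 1) = 2 * i + 1 by ring.
have -> : i + j - (i - j + 1) = 2 * j - 1 by ring.
rewrite (expfzDr _ _ u0) uE !(expfzDr _ _ v0) (expfzDr _ _ x0) (expfzDr _ _ y0) !expr1z -!invr_expz expr1z /u; field.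
by rewrite v0 y0 !expfz_neq0.
Qed.

Lemma zsum_tterm_cvg (w : C) : w != 0 ->
  exists l : R, (fun N => zsum N (fun m => normc (tterm w m))) @ \oo --> l.
Proof.
move=> w1; have [B B0 HB] := tterm_bound w1.
suff cv : cvgn (fun N => zsum N (fun m => normc (tterm w m))) by eexists; exact: cv.
apply: nondecreasing_is_cvgn.
  apply/nondecreasing_seqP => N; rewrite /zsum lerD2l big_ord_recr /= lerDl.
  by rewrite addr_ge0 ?normc_ge0.
exists (B * 3) => _ [N _ <-].
apply: (@le_trans _ _ (B * zsum N (fun m => (2^-1 : R) ^+ `|m|%N))); last first.
  by apply: ler_wpM2l => //; apply: zsum_half.
rewrite -!sum_zr big_distrr /=; apply: ler_sum => m _; apply: le_trans (HB m) _.
apply: ler_wpM2l => //; apply: lerXn2r; rewrite ?nnegrE ?divr_ge0 ?invr_ge0 ?normc_ge0 //.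
by rewrite ler_pdivrMr // mulVf ?pnatr_eq0 // ltW.
Qed.

Lemma cvg_doubleS (u : nat -> R) (l : R) : u @ \oo --> l -> (fun n => u n.*2.+1) @ \oo --> l.
Proof.
move=> ul; apply/cvgrPdist_lt => e e0; move/cvgrPdist_lt: ul => /(_ e e0) [K _ HK].
by exists K => // n /= Kn; apply: HK; rewrite /=; lia.
Qed.

(** The product of the two series converges over squares. The diamond lies between the squares of
    sizes N and 2N + 1, whose sums of absolute values have the same limit, so diamonds give the same
    value. *)
Lemma diamond_cvg : exists2 k : C, k != 0 & forall x y : C, x != 0 -> y != 0 ->
  ccvg (fun N => fser N x * gser N y - gser N x * fser N y)
       (k * (y * Eth p (x * y) * Eth p (x / y))).
Proof.
have [k k0 HE] := Eth_series; exists (k * k); first exact: mulf_neq0.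
move=> x y x0 y0; have v0 := w0_neq0.
have xy0 : x * y != 0 by rewrite mulf_neq0.
have xy0' : x / y != 0 by rewrite mulf_neq0 ?invr_eq0.
set w1 := - (x * y) / w0; set w2 := - (x / y) / w0.
have w10 : w1 != 0 by rewrite mulf_neq0 ?oppr_eq0 ?invr_eq0.
have w20 : w2 != 0 by rewrite mulf_neq0 ?oppr_eq0 ?invr_eq0.
have cS := ccvgM (HE _ xy0) (HE _ xy0').
have [l1 c1] := zsum_tterm_cvg w10; have [l2 c2] := zsum_tterm_cvg w20.
pose A N := zsum N (fun m => normc (tterm w1 m)) * zsum N (fun m => normc (tterm w2 m)).
have cA : A @ \oo --> l1 * l2 by exact: (@cvgM R nat \oo _ _ _ _ _ c1 c2).
have cD : (fun N => A N.*2.+1 - A N) @ \oo --> (0 : R).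
  rewrite -[0](subrr (l1 * l2)).
  exact: (@cvgB R R^o nat \oo _ _ _ _ _ (cvg_doubleS cA) cA).
pose T N := \sum_(z <- diamond N) tterm w1 z.1 * tterm w2 z.2.
have c0 : ccvg (fun N => T N - zsum N (tterm w1) * zsum N (tterm w2)) 0.
  apply: (ccvg_squeeze _ cD) => N; rewrite subr0 -sum_square.
  rewrite /A -!sum_square_normc; apply: region_bound.
  - exact: uniq_square.
  - exact: uniq_diamond.
  - exact: uniq_square.
  - exact: square_sub_diamond.
  - exact: diamond_sub_square.
have cT := ccvgM (ccvg_cst y) (ccvgD c0 cS).
have -> : k * k * (y * Eth p (x * y) * Eth p (x / y)) =
  y * (0 + k * Eth p (x * y) * (k * Eth p (x / y))) by ring.
by apply: (ccvg_ext cT) => N; rewrite subrK sum_diamond.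
Qed.

(** The relation between the 2 x 2 minors of the matrix with columns (f_i, g_i). *)
Lemma plucker_minors (K : comNzRingType) (f1 g1 f2 g2 f3 g3 f4 g4 : K) :
  (f1 * g2 - g1 * f2) * (f3 * g4 - g3 * f4) =
  (f1 * g3 - g1 * f3) * (f2 * g4 - g2 * f4) + - ((f1 * g4 - g1 * f4) * (f2 * g3 - g2 * f3)).
Proof. ring. Qed.

Lemma Eth_plucker_neq0 (x y u v : C) : x != 0 -> y != 0 -> u != 0 -> v != 0 ->
  let W x y := y * Eth p (x * y) * Eth p (x / y) in
  W x y * W u v = W x u * W y v - W x v * W y u.
Proof.
move=> x0 y0 u0 v0 W; have [k k0 H] := diamond_cvg.
have k2 : k * k != 0 by rewrite mulf_neq0.
apply: (mulfI k2).
have c1 := ccvgM (H x y x0 y0) (H u v u0 v0).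
have c2 := ccvgD (ccvgM (H x u x0 u0) (H y v y0 v0)) (ccvgN (ccvgM (H x v x0 v0) (H y u y0 u0))).
have -> : k * k * (W x y * W u v) = k * W x y * (k * W u v) by ring.
have -> : k * k * (W x u * W y v - W x v * W y u) =
  k * W x u * (k * W y v) + - (k * W x v * (k * W y u)) by ring.
rewrite /W; have E N := plucker_minors (fser N x) (gser N x) (fser N y) (gser N y)
  (fser N u) (gser N u) (fser N v) (gser N v).
exact (ccvg_unique c1 (ccvg_ext c2 (fun N => esym (E N)))).
Qed.

End TripleProduct.

Section Plucker.
Variables (R : realType) (p : R[i]).
Local Notation C := R[i].
Hypothesis hp : normc p < 1.

(** The case p = 0 is separate because the theta series divides by the square root of p. *)
Lemma Eth_p0 (x : C) : x != 0 -> Eth 0 x = 1 - x.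
Proof.
move=> x0; have h0 : normc (0 : C) < 1 by rewrite normc0.
apply: (ccvg_unique (Eth_cvg h0 x0)).
have T n : theta_partial 0 x n.+1 = 1 - x.
  elim: n => [|n IH]; first by rewrite /theta_partial big_ord1 /= expr0 expr1 mul0r mulr1 subr0 mulr1.
  by rewrite /theta_partial big_ord_recr /= -/(theta_partial _ _ _) IH !expr0n /= mul0r mulr0 subr0 !mulr1.
by apply/cvgrPdist_lt => e e0; exists 1%N => // -[//|n] _; rewrite /= T subrr normr0.
Qed.

Lemma Eth_plucker (x y u v : C) : x != 0 -> y != 0 -> u != 0 -> v != 0 ->
  let W x y := y * Eth p (x * y) * Eth p (x / y) in
  W x y * W u v = W x u * W y v - W x v * W y u.
Proof.
have [->|p0] := eqVneq p 0; last exact: (Eth_plucker_neq0 hp p0 (sqr_sqrtc p)).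
move=> x0 y0 u0 v0 W; rewrite /W !Eth_p0 ?mulf_neq0 ?invr_eq0 //.
by field; rewrite y0 u0 v0.
Qed.

End Plucker.

(** * The transformation for generic parameters *)

Section Characters.
Variables (R : realType) (p : R[i]) (G : comNzRingType) (chi : G -> R[i]).
Local Notation C := R[i].
Hypothesis hp : normc p < 1.
Hypothesis chiD : forall X Y, chi (X + Y) = chi X * chi Y.
Hypothesis chi_neq0 : forall X, chi X != 0.

Lemma epochs_cons2 (Q x y : C) s k :
  epochs p Q (x :: y :: s) k = epoch p Q x k * epochs p Q (y :: s) k.
Proof. exact: big_cons. Qed.

Lemma epochs1 (Q x : C) k : epochs p Q [:: x] k = epoch p Q x k.
Proof. exact: big_seq1. Qed.

Lemma chi0 : chi 0 = 1.
Proof. by apply: (mulIf (chi_neq0 0)); rewrite -chiD addr0 mul1r. Qed.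

Lemma chiN X : chi (- X) = (chi X)^-1.
Proof. by apply: (mulIf (chi_neq0 X)); rewrite -chiD addNr chi0 mulVf. Qed.

(** The parameter itself; [chi X] is its chosen square root. *)
Definition zeta X : C := chi X ^+ 2.

Lemma zetaD X Y : zeta (X + Y) = zeta X * zeta Y.
Proof. by rewrite /zeta chiD exprMn. Qed.

Lemma zetaN X : zeta (- X) = (zeta X)^-1.
Proof. by rewrite /zeta chiN exprVn. Qed.

Lemma zetaM n X : zeta (n%:R * X) = zeta X ^+ n.
Proof.
elim: n => [|n IH]; first by rewrite mul0r /zeta chi0 expr1n.
by rewrite -natr1 mulrDl mul1r zetaD IH exprSr.
Qed.

Lemma zeta_neq0 X : zeta X != 0.
Proof. exact: expf_neq0. Qed.

Definition hE X : C := Eth p (zeta X) / chi X.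

Lemma EthE X : Eth p (zeta X) = chi X * hE X.
Proof. by rewrite /hE mulrC divfK. Qed.

Lemma hE_odd X : hE (- X) = - hE X.
Proof.
rewrite /hE zetaN (Eth_inv hp (zeta_neq0 X)) chiN invrK /zeta; field; exact: chi_neq0.
Qed.

Lemma hE0 : hE 0 = 0.
Proof. by rewrite /hE /zeta chi0 expr1n (Eth1 hp) mul0r. Qed.

(** The relation of [Eth_plucker] at the points zeta X / chi s: their products are zeta (X + Y - s),
    because chi s squared is zeta s. The remaining monomial factor is common to all three terms. *)
Lemma hE_plucker s x y u v :
  hE (x - y) * hE (x + y - s) * (hE (u - v) * hE (u + v - s)) =
  hE (x - u) * hE (x + u - s) * (hE (y - v) * hE (y + v - s)) -
  hE (x - v) * hE (x + v - s) * (hE (y - u) * hE (y + u - s)).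
Proof.
pose W X Y := zeta Y / chi s * Eth p ((zeta X / chi s) * (zeta Y / chi s)) *
  Eth p ((zeta X / chi s) / (zeta Y / chi s)).
have hW X Y : hE (X - Y) * hE (X + Y - s) = W X Y * (chi s ^+ 2 / (chi X ^+ 2 * chi Y ^+ 2)).
  rewrite /W /hE.
  have -> : zeta X / chi s * (zeta Y / chi s) = zeta (X + Y - s).
    by rewrite !zetaD zetaN /zeta; field; exact: chi_neq0.
  have -> : zeta X / chi s / (zeta Y / chi s) = zeta (X - Y).
    by rewrite !zetaD zetaN /zeta; field; rewrite !chi_neq0.
  by rewrite -[zeta Y]/(chi Y ^+ 2) !chiD !chiN; field; rewrite !chi_neq0.
have nz X : zeta X / chi s != 0 by rewrite mulf_neq0 ?zeta_neq0 ?invr_eq0.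
have := Eth_plucker hp (nz x) (nz y) (nz u) (nz v); rewrite !hW -/(W _ _) => H.
pose k := chi s ^+ 4 / (chi x ^+ 2 * chi y ^+ 2 * chi u ^+ 2 * chi v ^+ 2).
transitivity (W x y * W u v * k); first by rewrite /k; field; rewrite !chi_neq0.
transitivity ((W x u * W y v - W x v * W y u) * k); last by rewrite /k; field; rewrite !chi_neq0.
by congr (_ * _).
Qed.

(** The sum of the arguments X + i Q for i < k. *)
Definition wt X Q k : G := k%:R * X + 'C(k, 2)%:R * Q.

Lemma epochE Q X k : epoch p (zeta Q) (zeta X) k = chi (wt X Q k) * ph hE X Q k.
Proof.
rewrite /wt; elim: k => [|k IH].
  by rewrite /epoch big_ord0 ph0 bin0n !mul0r addr0 chi0 mulr1.
rewrite /epoch big_ord_recr /= -/(epoch _ _ _ _) IH phS -zetaM -zetaD EthE.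
have -> : k.+1%:R * X + 'C(k.+1, 2)%:R * Q = (k%:R * X + 'C(k, 2)%:R * Q) + (X + k%:R * Q).
  by rewrite binS bin1; ring.
by rewrite [in RHS]chiD; ring.
Qed.

Lemma epoch_neq0 Q X k : (epoch p (zeta Q) (zeta X) k != 0) = (ph hE X Q k != 0).
Proof. by rewrite epochE mulf_eq0 (negbTE (chi_neq0 _)). Qed.

Section Conversion.
Variables (n : nat) (Q A B Cc D E F : G).
Hypothesis sumBCD : B + Cc + D = A + A + Q.
Hypothesis sumEF : E + F = A + (n + 1)%:R * Q.
Let q := zeta Q. Let a := zeta A. Let b := zeta B. Let c := zeta Cc. Let d := zeta D.
Let e := zeta E. Let f := zeta F.

Let DE : D = A + A + Q - B - Cc. Proof. by rewrite -sumBCD; ring. Qed.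
Let FE : F = A + (n + 1)%:R * Q - E. Proof. by rewrite -sumEF; ring. Qed.

Lemma lhs_conv :
  \sum_(k < n.+1)
     (Eth p (a * q ^+ (3 * k)) / Eth p a) *
     (epochs p (q ^+ 2) [:: b; c; d] k / epochs p q [:: a * q / b; a * q / c; a * q / d] k) *
     (epochs p q [:: e; f; q ^- n] k /
        epochs p (q ^+ 2) [:: a * q ^+ 2 / e; a * q ^+ 2 / f; a * q ^+ n.+2] k) *
     q ^+ k = quad_lhs hE Q n A B Cc D E F.
Proof.
apply: eq_bigr => k _; rewrite !epochs_cons2 !epochs1.
have q2 : q ^+ 2 = zeta (Q + Q) by rewrite zetaD expr2.
have ax x X : x = zeta X -> a * q / x = zeta (A + Q - X) by move=> ->; rewrite !zetaD zetaN.
have ay x X : x = zeta X -> a * q ^+ 2 / x = zeta (A + (Q + Q) - X).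
  by move=> ->; rewrite q2 !zetaD zetaN.
rewrite (ax b B erefl) (ax c Cc erefl) (ax d D erefl) (ay e E erefl) (ay f F erefl) q2.
have -> : q ^- n = zeta (- (n%:R * Q)) by rewrite zetaN zetaM.
have -> : a * q ^+ n.+2 = zeta (A + (n + 2)%:R * Q) by rewrite zetaD zetaM addn2.
have -> : a * q ^+ (3 * k) = zeta (A + (3 * k)%:R * Q) by rewrite zetaD zetaM.
have -> : q ^+ k = chi ((2 * k)%:R * Q).
  by rewrite -zetaM /zeta expr2 -chiD; congr chi; ring.
rewrite !EthE !epochE.
(* All monomials multiply to 1: the binomial terms cancel between equally many products of each base
   above and below, the rest by the two balancing conditions. *)
have key : chi (A + (3 * k)%:R * Q) * chi (- A) *
   (chi (wt B (Q + Q) k) * chi (wt Cc (Q + Q) k) * chi (wt D (Q + Q) k)) *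
   (chi (- wt (A + Q - B) Q k) * chi (- wt (A + Q - Cc) Q k) * chi (- wt (A + Q - D) Q k)) *
   (chi (wt E Q k) * chi (wt F Q k) * chi (wt (- (n%:R * Q)) Q k)) *
   (chi (- wt (A + (Q + Q) - E) (Q + Q) k) * chi (- wt (A + (Q + Q) - F) (Q + Q) k) *
    chi (- wt (A + (n + 2)%:R * Q) (Q + Q) k)) * chi ((2 * k)%:R * Q) = 1.
  by rewrite -!chiD -chi0; congr chi; rewrite /wt FE DE; ring.
rewrite !chiN in key; rewrite -[RHS]mul1r -key !invfM; ring.
Qed.

Lemma rhs_conv :
  (epochs p q [:: a * q; a * q / (b * c)] n *
       epochs p (q ^+ 2) [:: a * q / q ^+ n / b; a * q / q ^+ n / c] n) /
    (epochs p q [:: a * q / b; a * q / c] n *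
       epochs p (q ^+ 2) [:: a * q / q ^+ n; a * q / q ^+ n / (b * c)] n) *
    omega p (q ^+ 2) (a ^+ 2 / (e * f))
      [:: b; c; d; a / e; a / f; q / q ^+ n; q ^- n] n./2 =
  quad_rhs hE Q n A B Cc D E F.
Proof.
have q2 : q ^+ 2 = zeta (Q + Q) by rewrite zetaD expr2.
have an : a * q / q ^+ n = zeta (A + Q - n%:R * Q) by rewrite !zetaD zetaN zetaM.
rewrite /quad_rhs; congr (_ * _).
  rewrite !epochs_cons2 !epochs1 q2 an.
  have -> : a * q = zeta (A + Q) by rewrite zetaD.
  have -> : zeta (A + Q) / (b * c) = zeta (A + Q - B - Cc) by rewrite !zetaD !zetaN invfM; ring.
  have -> : zeta (A + Q - n%:R * Q) / (b * c) = zeta (A + Q - n%:R * Q - B - Cc).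
    by rewrite [zeta (_ - Cc)]zetaD [zeta (_ - B)]zetaD !zetaN invfM; ring.
  rewrite -!zetaN -!zetaD !epochE.
  have key : chi (wt (A + Q) Q n) * chi (wt (A + Q - B - Cc) Q n) *
    (chi (wt (A + Q - n%:R * Q - B) (Q + Q) n) * chi (wt (A + Q - n%:R * Q - Cc) (Q + Q) n)) *
    (chi (- wt (A + Q - B) Q n) * chi (- wt (A + Q - Cc) Q n) *
     (chi (- wt (A + Q - n%:R * Q) (Q + Q) n) *
      chi (- wt (A + Q - n%:R * Q - B - Cc) (Q + Q) n))) = 1.
    by rewrite -!chiD -chi0; congr chi; rewrite /wt; ring.
  rewrite !chiN in key; rewrite -[RHS]mul1r -key !invfM; ring.
rewrite /omega; apply: eq_bigr => j _.
have -> : a ^+ 2 / (e * f) = zeta (A - (n + 1)%:R * Q).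
  rewrite -zetaD sumEF expr2 -zetaD -zetaN -zetaD; congr zeta; ring.
set A1 := A - (n + 1)%:R * Q.
rewrite !epochs_cons2 !epochs1 q2.
have -> : zeta A1 * zeta (Q + Q) ^+ (2 * j) = zeta (A1 + (4 * j)%:R * Q).
  by rewrite -zetaM -zetaD; congr zeta; ring.
have ax x X : x = zeta X -> zeta A1 * zeta (Q + Q) / x = zeta (A + Q - n%:R * Q - X).
  by move=> ->; rewrite -zetaN -!zetaD; congr zeta; rewrite /A1; ring.
have ae : a / e = zeta (A - E) by rewrite zetaD zetaN.
have af : a / f = zeta (A - F) by rewrite zetaD zetaN.
have qn : q / q ^+ n = zeta (Q - n%:R * Q) by rewrite zetaD zetaN zetaM.
have qn' : q ^- n = zeta (- (n%:R * Q)) by rewrite zetaN zetaM.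
rewrite (ax _ _ ae) (ax _ _ af) (ax _ _ qn) (ax _ _ qn') (ax b B erefl) (ax c Cc erefl) (ax d D erefl).
rewrite ae af qn qn'.
have -> : A + Q - n%:R * Q - (A - E) = A + (Q + Q) - F by rewrite FE; ring.
have -> : A + Q - n%:R * Q - (A - F) = A + (Q + Q) - E by rewrite FE; ring.
have -> : A + Q - n%:R * Q - (Q - n%:R * Q) = A by ring.
have -> : A + Q - n%:R * Q - (- (n%:R * Q)) = A + Q by ring.
have -> : zeta (Q + Q) ^+ j = chi ((4 * j)%:R * Q).
  by rewrite -zetaM /zeta expr2 -chiD; congr chi; ring.
rewrite !EthE !epochE.
have key : chi (A1 + (4 * j)%:R * Q) * chi (- A1) *
  (chi (wt A1 (Q + Q) j) * (chi (wt B (Q + Q) j) * (chi (wt Cc (Q + Q) j) * (chi (wt D (Q + Q) j) *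
   (chi (wt (A - E) (Q + Q) j) * (chi (wt (A - F) (Q + Q) j) *
   (chi (wt (Q - n%:R * Q) (Q + Q) j) * chi (wt (- (n%:R * Q)) (Q + Q) j))))))) *
   chi ((4 * j)%:R * Q)) *
  (chi (- wt (Q + Q) (Q + Q) j) * (chi (- wt (A + Q - n%:R * Q - B) (Q + Q) j) *
   (chi (- wt (A + Q - n%:R * Q - Cc) (Q + Q) j) * (chi (- wt (A + Q - n%:R * Q - D) (Q + Q) j) *
   (chi (- wt (A + (Q + Q) - F) (Q + Q) j) * (chi (- wt (A + (Q + Q) - E) (Q + Q) j) *
   (chi (- wt A (Q + Q) j) * chi (- wt (A + Q) (Q + Q) j)))))))) = 1.
  by rewrite -!chiD -chi0; congr chi; rewrite /wt FE DE /A1; ring.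
rewrite !chiN in key; rewrite -[RHS]mul1r -key !invfM; ring.
Qed.

End Conversion.
End Characters.

(** * The generic transformation for complex parameters *)

Section Transformation.
Variables (R : realType) (p : R[i]).
Local Notation C := R[i].
Hypothesis hp : normc p < 1.
Implicit Types (q a b c d e f : C) (n : nat).

Definition trans_lhs q a b c d e f n : C :=
  \sum_(k < n.+1)
     (Eth p (a * q ^+ (3 * k)) / Eth p a) *
     (epochs p (q ^+ 2) [:: b; c; d] k / epochs p q [:: a * q / b; a * q / c; a * q / d] k) *
     (epochs p q [:: e; f; q ^- n] k /
        epochs p (q ^+ 2) [:: a * q ^+ 2 / e; a * q ^+ 2 / f; a * q ^+ n.+2] k) *
     q ^+ k.

Definition trans_rhs q a b c d e f n : C :=
  (epochs p q [:: a * q; a * q / (b * c)] n *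
       epochs p (q ^+ 2) [:: a * q / q ^+ n / b; a * q / q ^+ n / c] n) /
    (epochs p q [:: a * q / b; a * q / c] n *
       epochs p (q ^+ 2) [:: a * q / q ^+ n; a * q / q ^+ n / (b * c)] n) *
    omega p (q ^+ 2) (a ^+ 2 / (e * f))
      [:: b; c; d; a / e; a / f; q / q ^+ n; q ^- n] n./2.

Definition trans_dens q a b c d e f n : seq C :=
  [:: Eth p a; epochs p q [:: a * q / b; a * q / c; a * q / d] n;
      epochs p (q ^+ 2) [:: a * q ^+ 2 / e; a * q ^+ 2 / f; a * q ^+ n.+2] n;
      epochs p (q ^+ 2) [:: a * q / q ^+ n; a * q / q ^+ n / (b * c)] n;
      Eth p (a ^+ 2 / (e * f));
      epochs p (q ^+ 2)
          (q ^+ 2 :: [seq a ^+ 2 / (e * f) * q ^+ 2 / ai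
                     | ai <- [:: b; c; d; a / e; a / f; q / q ^+ n; q ^- n]]) n./2].

Lemma epochs_neq0 (Q : C) s m : (epochs p Q s m != 0) = all (fun x => epoch p Q x m != 0) s.
Proof. by rewrite prodf_seq_neq0; apply: eq_all => x. Qed.

Definition ngen q (x : C) := forall i j : nat, Eth p (x * q ^+ i / q ^+ j) != 0.

Lemma trans_generic q a b c d e f n :
  q != 0 -> a != 0 -> b != 0 -> c != 0 -> d != 0 -> e != 0 -> f != 0 ->
  b * c * d = a ^+ 2 * q -> e * f = a * q ^+ n.+1 ->
  (forall i j : nat, i != j -> Eth p (q ^+ i / q ^+ j) != 0) ->
  ngen q a -> ngen q c -> ngen q (c / a) ->
  all (fun z => z != 0) (trans_dens q a b c d e f n) ->
  trans_lhs q a b c d e f n = trans_rhs q a b c d e f n.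
Proof.
move=> q0 a0 b0 c0 d0 e0 f0 hbcd hef gq ga gc gca.
(* Five free parameters; d and f follow from the balancing conditions. The default 1 keeps [r k]
   nonzero for all k. *)
pose r k := nth 1 [:: sqrtc q; sqrtc a; sqrtc b; sqrtc c; sqrtc e] k.
have r0 k : r k != 0.
  by do 5 (case: k => [|k]; first by rewrite /r /= sqrtc_eq0); rewrite /r /= nth_nil oner_neq0.
(* [{poly int}] serves as the free abelian group of exponent vectors of the square roots [r k]. *)
pose chi (P : {poly int}) : C := \prod_(k < 5) r k ^ P`_k.
have chiD X Y : chi (X + Y) = chi X * chi Y.
  rewrite /chi -big_split /=; apply: eq_bigr => k _; by rewrite coefD expfzDr.
have chi_neq0 X : chi X != 0 by apply/prodf_neq0 => k _; apply: expfz_neq0.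
have chiX (k : 'I_5) : zeta chi 'X^k = r k ^+ 2.
  rewrite /zeta; congr (_ ^+ 2); rewrite /chi (bigD1 k) //= coefXn eqxx expr1z big1 ?mulr1 //.
  by move=> j jk; rewrite coefXn -[(_ == _)]/(val j == val k) val_eqE (negbTE jk) expr0z.
pose Q : {poly int} := 'X^0; pose A : {poly int} := 'X^1; pose B : {poly int} := 'X^2.
pose Cc : {poly int} := 'X^3; pose E : {poly int} := 'X^4.
have zQ : zeta chi Q = q by rewrite (chiX (@Ordinal 5 0 isT)) sqr_sqrtc.
have zA : zeta chi A = a by rewrite (chiX (@Ordinal 5 1 isT)) sqr_sqrtc.
have zB : zeta chi B = b by rewrite (chiX (@Ordinal 5 2 isT)) sqr_sqrtc.
have zC : zeta chi Cc = c by rewrite (chiX (@Ordinal 5 3 isT)) sqr_sqrtc.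
have zE : zeta chi E = e by rewrite (chiX (@Ordinal 5 4 isT)) sqr_sqrtc.
clearbody Q A B Cc E.
have zD := zetaD chiD; have zN := zetaN chiD chi_neq0; have zM := zetaM chiD chi_neq0.
pose D := A + A + Q - B - Cc; pose F := A + (n + 1)%:R * Q - E.
have sBCD : B + Cc + D = A + A + Q by rewrite /D; ring.
have sEF : E + F = A + (n + 1)%:R * Q by rewrite /F; ring.
have zDd : zeta chi D = d.
  have bc0 : b * c != 0 by rewrite mulf_neq0.
  by apply: (mulfI bc0); rewrite hbcd -zB -zC -2!zD sBCD !zD zA zQ expr2.
have zFf : zeta chi F = f.
  by apply: (mulfI e0); rewrite hef -zE -zD sEF zD zM zA zQ addn1.
clearbody D F.
have nz := epoch_neq0 p chiD chi_neq0.
have hEn X : (hE p chi X != 0) = (Eth p (zeta chi X) != 0).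
  by rewrite /hE mulf_eq0 invr_eq0 (negbTE (chi_neq0 X)) orbF.
have gen_of X x : zeta chi X = x -> ngen q x -> gen (hE p chi) Q X.
  by move=> zX gx i j; rewrite hEn !zD zN !zM zX zQ; exact: gx.
have q2 : q ^+ 2 = zeta chi (Q + Q) by rewrite zD zQ expr2.
move=> /and5P [n1 N2 N3 N4 /and3P [n5 N6 _]].
move: N2; rewrite epochs_neq0 => /and4P [m1 m2 m3 _].
move: N3; rewrite epochs_neq0 => /and4P [m4 m5 m6 _].
move: N4; rewrite epochs_neq0 => /and3P [_ m7 _].
move: N6; rewrite epochs_neq0 => /and5P [_ m8 m9 m10 _].
have e1 : a ^+ 2 / (e * f) * q ^+ 2 = zeta chi (A + Q - n%:R * Q).
  have -> : A + Q - n%:R * Q = A + A + (Q + Q) - (A + (n + 1)%:R * Q) by ring.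
  by rewrite zD zN -sEF !zD zA zQ zE zFf !expr2; ring.
have nz1 : hE p chi A != 0 by rewrite hEn zA.
have cn Qz X x q' m : zeta chi Qz = q' -> zeta chi X = x ->
    epoch p q' x m != 0 -> ph (hE p chi) X Qz m != 0 by move=> <- <-; rewrite nz.
have zx X x : zeta chi X = x -> zeta chi (A + Q - X) = a * q / x by move=> <-; rewrite zD zN zD zA zQ.
have zy X x : zeta chi X = x -> zeta chi (A + (Q + Q) - X) = a * q ^+ 2 / x.
  by move=> <-; rewrite zD zN zD zA -q2.
have zw X x : zeta chi X = x ->
    zeta chi (A + Q - n%:R * Q - X) = a ^+ 2 / (e * f) * q ^+ 2 / x.
  by move=> <-; rewrite zD zN e1.
have z6 : zeta chi (A + (n + 2)%:R * Q) = a * q ^+ n.+2 by rewrite zD zM zA zQ addn2.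
have z7 : zeta chi (A + Q - n%:R * Q - B - Cc) = a * q / q ^+ n / (b * c).
  by rewrite (zD _ (- Cc)) (zD _ (- B)) !zN zD zN zM zD zA zQ zB zC invfM; ring.
have b1 := cn _ _ _ _ _ zQ (zx _ _ zB) m1.
have b2 := cn _ _ _ _ _ zQ (zx _ _ zC) m2.
have b3 := cn _ _ _ _ _ zQ (zx _ _ zDd) m3.
have b4 := cn _ _ _ _ _ (esym q2) (zy _ _ zE) m4.
have b5 := cn _ _ _ _ _ (esym q2) (zy _ _ zFf) m5.
have b6 := cn _ _ _ _ _ (esym q2) z6 m6.
have b7 := cn _ _ _ _ _ (esym q2) z7 m7.
have b8 := cn _ _ _ _ _ (esym q2) (zw _ _ zB) m8.
have b9 := cn _ _ _ _ _ (esym q2) (zw _ _ zC) m9.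
have b10 := cn _ _ _ _ _ (esym q2) (zw _ _ zDd) m10.
have nD : quad_den (hE p chi) Q n A B Cc D E F != 0.
  by rewrite /quad_den; do ! apply: mulf_neq0 => //.
have hq i j : i != j -> hE p chi (i%:R * Q - j%:R * Q) != 0.
  by move=> ij; rewrite hEn zD zN !zM zQ gq.
transitivity (quad_lhs (hE p chi) Q n A B Cc D E F).
  by rewrite -(lhs_conv p chiD chi_neq0 sBCD sEF) zA zB zC zDd zE zFf zQ.
transitivity (quad_rhs (hE p chi) Q n A B Cc D E F); last first.
  by rewrite -(rhs_conv p chiD chi_neq0 sBCD sEF) zA zB zC zDd zE zFf zQ.
apply: (quad_transform (hE_odd hp chiD chi_neq0) (hE0 hp chiD chi_neq0)
  (hE_plucker hp chiD chi_neq0) hq (gen_of _ _ zA ga) (gen_of _ _ zC gc)) => //.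
by apply: (gen_of _ (c / a)) => //; rewrite zD zN zC zA.
Qed.

End Transformation.

(** * Passage to arbitrary parameters *)

Section Perturbation.
Variables (R : realType) (p : R[i]).
Local Notation C := R[i].
Hypothesis hp : normc p < 1.

(** Each condition excludes at most one t > 0, and an interval of positive Lebesgue measure is not
    countable. *)
Lemma avoid_countable (T : countType) (bad : T -> R -> Prop) (eps : R) : 0 < eps ->
  (forall m t t', 0 < t -> 0 < t' -> bad m t -> bad m t' -> t = t') ->
  exists t, 0 < t < eps /\ forall m, ~ bad m t.
Proof.
move=> e0 inj; apply: contrapT => H.
pose S m : set R := [set t | 0 < t /\ bad m t].
have sub : `]0, eps[%classic `<=` \bigcup_m S m.
  move=> t /=; rewrite in_itv /= => /andP [t0 te].
  apply: contrapT => nS; apply: H; exists t; rewrite t0 te; split=> // m bm.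
  by apply: nS; exists m.
have cS : countable (\bigcup_m S m).
  apply: bigcup_countable; first exact: countableP.
  move=> m _; have [->|/set0P [t [t0 bt]]] := eqVneq (S m) set0; first exact: countable0.
  have -> : S m = [set t] by apply/seteqP; split => [t' [t'0 bt']|_ ->] //=; exact: inj bt' bt.
  exact: countable1.
have := countable_lebesgue_measure0 (sub_countable (subset_card_le sub) cS).
rewrite lebesgue_measure_itv /= lte_fin e0 oppr0 adde0 => /eqP.
by rewrite eqe gt_eqF.
Qed.

(** Since the exponents differ, the argument of E is injective in t. The zeros of E are powers of p,
    so each pair of an index and a zero excludes at most one t. *)
Lemma perturb (T : countType) (u : T -> C) (i j : T -> nat) (eps : R) : 0 < eps ->
  (forall m, u m != 0) -> (forall m, i m != j m) ->
  exists t : R, 0 < t < eps /\ forall m, Eth p (u m * (1 + t)%:C ^+ i m / (1 + t)%:C ^+ j m) != 0.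
Proof.
move=> e0 u0 ij.
pose z m (t : R) := u m * (1 + t)%:C ^+ i m / (1 + t)%:C ^+ j m.
have s0 (t : R) : 0 < t -> (1 + t)%:C != 0 :> C.
  by move=> t0; rewrite -[0]/(0%:C) (inj_eq (@complexI R)) gt_eqF // ltr_wpDr // ltW.
pose bad (x : T * nat * bool) (t : R) :=
  if x.2 then z x.1.1 t * p ^+ x.1.2 = 1 else z x.1.1 t = p ^+ x.1.2.+1.
have pw (k l : nat) (s s' : R) : 0 < s -> 0 < s' -> (k < l)%N ->
    s ^+ k * s' ^+ l = s' ^+ k * s ^+ l -> s = s'.
  move=> sp sp' kl; rewrite -(subnKC kl) addSnnS !exprD => E.
  have {}E : s' ^+ (l - k.+1).+1 = s ^+ (l - k.+1).+1.
    by apply: (mulfI (lt0r_neq0 (mulr_gt0 (exprn_gt0 k sp) (exprn_gt0 k sp')))); rewrite -mulrA E; ring.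
  by apply/esym; apply: (pexpIrn (n := (l - k.+1).+1)); rewrite ?nnegrE ?ltW.
have zinj m (t t' : R) : 0 < t -> 0 < t' -> z m t = z m t' -> t = t'.
  move=> t0 t'0; rewrite /z -!mulrA => /(mulfI (u0 m)) /eqP.
  rewrite eqr_div ?expf_neq0 ?s0 // -!rmorphXn -!rmorphM (inj_eq (@complexI R)) => /eqP E.
  have P1 : 0 < 1 + t by lra.
  have P2 : 0 < 1 + t' by lra.
  suff : 1 + t = 1 + t' by move/addrI.
  have := ij m; rewrite neq_ltn => /orP [l|l]; first exact: pw l E.
by apply: pw l _ => //; rewrite mulrC -E mulrC.
have [t [te Ht]] : exists t, 0 < t < eps /\ forall m, ~ bad m t.
  apply: avoid_countable => // -[[m k] [|]] t t' t0 t'0; rewrite /bad /=.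
    move=> e1 e2; apply: (zinj m t t' t0 t'0).
    have pk : p ^+ k != 0.
      (* If p^k = 0, the equation z p^k = 1 has no solution. *)
      by apply/eqP => pk; move: e1; rewrite pk mulr0 => /eqP; rewrite eq_sym oner_eq0.
    exact: (mulIf pk (etrans e1 (esym e2))).
  by move=> e1 e2; apply: (zinj m t t' t0 t'0); exact: etrans e1 (esym e2).
exists t; split=> // m; have /andP [t0 _] := te.
have z0 : z m t != 0 by rewrite !mulf_neq0 ?invr_eq0 ?expf_neq0 ?s0.
apply/eqP => /(Eth_eq0 hp z0) [k [h|h]].
- exact: (Ht (m, k, true)).
- exact: (Ht (m, k, false)).
Qed.

Lemma perturb_factor (x : C) (t : R) : 0 < t -> x != 0 ->
  x * (1 + t)%:C != 0 /\ normc (x * (1 + t)%:C - x) = normc x * t.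
Proof.
move=> t0 x0; split.
  by rewrite mulf_neq0 // -[0]/(0%:C) (inj_eq (@complexI R)) gt_eqF //; lra.
have -> : x * (1 + t)%:C - x = x * t%:C by rewrite rmorphD rmorph1; ring.
by rewrite normcM [normc t%:C]/normc /= expr0n /= addr0 sqrtr_sqr gtr0_norm.
Qed.

(** The order matters: q is moved first, then a with the new q fixed, then c with both fixed. Each
    step meets countably many conditions in one real factor 1 + t. *)
Lemma generic_approx (q a c : C) (eps : R) : q != 0 -> a != 0 -> c != 0 -> 0 < eps ->
  exists x : C * C * C, let: (q', a', c') := x in
  [/\ q' != 0, a' != 0, c' != 0, [/\ normc (q' - q) <= normc q * eps,
    normc (a' - a) <= normc a * eps & normc (c' - c) <= normc c * eps] &
   [/\ forall i j : nat, i != j -> Eth p (q' ^+ i / q' ^+ j) != 0,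
       ngen p q' a', ngen p q' c' & ngen p q' (c' / a')]].
Proof.
move=> q0 a0 c0 e0.
have [||t1 [/andP [t10 t1e] H1]] := @perturb {x : nat * nat | x.1 != x.2}
  (fun x => q ^+ (val x).1 / q ^+ (val x).2) (fun x => (val x).1) (fun x => (val x).2) _ e0.
- by move=> m; rewrite mulf_neq0 ?invr_eq0 ?expf_neq0.
- by case.
set s1 := (1 + t1)%:C in H1; have [q'0 nq] := perturb_factor t10 q0; set q' := q * _ in q'0 nq.
have [||t2 [/andP [t20 t2e] H2]] := @perturb (nat * nat)%type
  (fun x => a * q' ^+ x.1 / q' ^+ x.2) (fun=> 1%N) (fun=> 0%N) _ e0.
- by move=> m; rewrite !mulf_neq0 ?invr_eq0 ?expf_neq0.
- by [].
have [a'0 na] := perturb_factor t20 a0; set a' := a * _ in a'0 na.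
have [||t3 [/andP [t30 t3e] H3]] := @perturb (nat * nat * bool)%type
  (fun x => c * (if x.2 then a'^-1 else 1) * q' ^+ x.1.1 / q' ^+ x.1.2) (fun=> 1%N) (fun=> 0%N) _ e0.
- by move=> [m [|]]; rewrite !mulf_neq0 ?invr_eq0 ?expf_neq0 ?oner_neq0.
- by [].
have [c'0 nc] := perturb_factor t30 c0; set c' := c * _ in c'0 nc.
exists (q', a', c'); split=> //.
  by rewrite nq na nc; split; (apply: ler_wpM2l; [exact: normc_ge0 | exact: ltW]).
split.
- move=> i j ij; have := H1 (exist _ (i, j) ij); rewrite /= /q' !exprMn.
  by congr (Eth p _ != 0); rewrite invfM; ring.
- by move=> i j; have := H2 (i, j); congr (Eth p _ != 0); rewrite /a' /= expr0 expr1 divr1; ring.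
- move=> i j; have := H3 (i, j, false); congr (Eth p _ != 0).
  by rewrite /c' /= expr0 expr1 divr1; ring.
- move=> i j; have := H3 (i, j, true); congr (Eth p _ != 0).
  by rewrite /c' /= expr0 expr1 divr1; ring.
Qed.

End Perturbation.

(** * Continuity of both sides and the limit *)

Section Limit.
Variables (R : realType) (p : R[i]).
Local Notation C := R[i].
Hypothesis hp : normc p < 1.

(** Nonzero terms and limit are bundled because continuity of E is available away from 0 only. *)
Definition nzcvg (u : nat -> C) (l : C) := [/\ ccvg u l, l != 0 & forall N, u N != 0].

Lemma nzcvg_cst (l : C) : l != 0 -> nzcvg (fun=> l) l.
Proof. by move=> l0; split=> //; exact: ccvg_cst. Qed.

Lemma nzcvgM u v (l m : C) : nzcvg u l -> nzcvg v m -> nzcvg (fun N => u N * v N) (l * m).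
Proof.
move=> [ul l0 u0] [vm m0 v0]; split; first exact: ccvgM ul vm.
  by rewrite mulf_neq0.
by move=> N; rewrite mulf_neq0.
Qed.

Lemma nzcvgV u (l : C) : nzcvg u l -> nzcvg (fun N => (u N)^-1) l^-1.
Proof.
move=> [ul l0 u0]; split; first exact: ccvgV l0 ul.
  by rewrite invr_eq0.
by move=> N; rewrite invr_eq0.
Qed.

Lemma nzcvgX u (l : C) k : nzcvg u l -> nzcvg (fun N => u N ^+ k) (l ^+ k).
Proof.
move=> [ul l0 u0]; split; first exact: ccvgX k ul.
  by rewrite expf_neq0.
by move=> N; rewrite expf_neq0.
Qed.

Lemma nzcvg_div u v (l m : C) : nzcvg u l -> nzcvg v m -> nzcvg (fun N => u N / v N) (l / m).
Proof. by move=> ul vm; exact: nzcvgM ul (nzcvgV vm). Qed.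

Lemma ccvg_div (u v : nat -> C) (l m : C) : ccvg u l -> ccvg v m -> m != 0 ->
  ccvg (fun N => u N / v N) (l / m).
Proof. by move=> ul vm m0; exact: ccvgM ul (ccvgV m0 vm). Qed.

Lemma ccvg_Eth u (l : C) : nzcvg u l -> ccvg (fun N => Eth p (u N)) (Eth p l).
Proof. by move=> [ul l0 u0]; exact (Eth_continuous hp l0 u0 ul). Qed.

Lemma ccvg_epoch Q_ (Q : C) u (l : C) k : nzcvg Q_ Q -> nzcvg u l ->
  ccvg (fun N => epoch p (Q_ N) (u N) k) (epoch p Q l k).
Proof.
move=> nQ nu; apply: ccvg_prod => i.
exact: ccvg_Eth (nzcvgM nu (nzcvgX i nQ)).
Qed.

Lemma epochs_cons (Q x : C) s k : epochs p Q (x :: s) k = epoch p Q x k * epochs p Q s k.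
Proof. exact: big_cons. Qed.

Fixpoint all_nzcvg (s : seq ((nat -> C) * C)) : Prop :=
  if s is z :: s' then nzcvg z.1 z.2 /\ all_nzcvg s' else True.

Lemma ccvg_epochs Q_ (Q : C) s k : nzcvg Q_ Q -> all_nzcvg s ->
  ccvg (fun N => epochs p (Q_ N) [seq z.1 N | z <- s] k) (epochs p Q [seq z.2 | z <- s] k).
Proof.
move=> nQ; elim: s => [_|[u l] s IH [nu ns]].
  have -> : (fun N => epochs p (Q_ N) [::] k) = fun=> 1 by apply/funext => N; exact: big_nil.
  by rewrite [epochs _ _ _ _]big_nil; exact: ccvg_cst.
have := ccvgM (@ccvg_epoch Q_ Q u l k nQ nu) (IH ns); rewrite -[X in ccvg _ X]epochs_cons.
by move/ccvg_ext; apply => N; rewrite -[LHS]epochs_cons.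
Qed.

Lemma epochs_neq0_le (Q : C) s k m : (k <= m)%N -> epochs p Q s m != 0 -> epochs p Q s k != 0.
Proof.
move=> km; rewrite !epochs_neq0 => /allP H; apply/allP => x xs; move: (H x xs).
rewrite -(subnKC km) /epoch big_split_ord mulf_eq0 negb_or /= => /andP [] //.
Qed.

Lemma ccvg_omega Q_ (Q : C) u (l : C) s m : nzcvg Q_ Q -> nzcvg u l -> all_nzcvg s ->
  Eth p l != 0 ->
  epochs p Q (Q :: [seq l * Q / ai | ai <- [seq z.2 | z <- s]]) m != 0 ->
  ccvg (fun N => omega p (Q_ N) (u N) [seq z.1 N | z <- s] m) (omega p Q l [seq z.2 | z <- s] m).
Proof.
move=> nQ nu ns El den; apply: ccvg_sum => k.
have c1 := ccvg_div (ccvg_Eth (nzcvgM nu (nzcvgX (2 * k) nQ))) (ccvg_Eth nu) El.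
have c2 := @ccvg_epochs Q_ Q ((u, l) :: s) k nQ (conj nu ns).
have c3 : ccvg (fun N => Q_ N ^+ k) (Q ^+ k) by case: nQ => cQ _ _; exact: ccvgX k cQ.
pose s' := (Q_, Q) :: [seq (fun N => u N * Q_ N / z.1 N, l * Q / z.2) | z <- s].
have ns' : all_nzcvg s'.
  split; first exact: nQ.
  elim: {c2 den s'} s ns => [|z s IH]; first exact: id.
  move=> [nz ns]; split; last exact: IH ns.
  exact: nzcvg_div (nzcvgM nu nQ) nz.
have c4 : ccvg (fun N => epochs p (Q_ N) (Q_ N :: [seq u N * Q_ N / ai | ai <- [seq z.1 N | z <- s]]) k)
    (epochs p Q (Q :: [seq l * Q / ai | ai <- [seq z.2 | z <- s]]) k).
  have := @ccvg_epochs Q_ Q s' k nQ ns'; rewrite /s' /= -!map_comp => /ccvg_ext; apply => N.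
  by rewrite -!map_comp.
have km : (k <= m)%N := leq_ord k.
exact: ccvg_div (ccvgM c1 (ccvgM c2 c3)) c4 (epochs_neq0_le km den).
Qed.

Lemma ccvg_unique_near (u v : nat -> C) (l m : C) : ccvg u l -> ccvg v m ->
  (\forall N \near \oo, u N = v N) -> l = m.
Proof.
move=> ul vm [K _ HK]; apply/eqP; rewrite -subr_eq0; apply/eqP.
have c1 := ccvgD ul (ccvgN vm); apply: (ccvg_unique c1).
apply/cvgrPdist_lt => e e0; exists K => // N KN /=.
by rewrite (HK N KN) subrr subr0 normr0.
Qed.

Section Continuity.
Variables (q_ a_ b_ c_ d_ e_ f_ : nat -> C) (q a b c d e f : C) (n : nat).
Hypotheses (nq : nzcvg q_ q) (na : nzcvg a_ a) (nb : nzcvg b_ b) (nc : nzcvg c_ c)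
  (nd : nzcvg d_ d) (ne : nzcvg e_ e) (nf : nzcvg f_ f).
Hypothesis dens : all (fun z => z != 0) (trans_dens p q a b c d e f n).

Let nq2 := nzcvgX 2 nq.
Let nx u l (nu : nzcvg u l) := nzcvg_div (nzcvgM na nq) nu.
Let ny u l (nu : nzcvg u l) := nzcvg_div (nzcvgM na nq2) nu.
Let nn := nzcvgM na (nzcvgX n.+2 nq).
Let nan := nzcvg_div (nzcvgM na nq) (nzcvgX n nq).
Let na1 := nzcvg_div (nzcvgX 2 na) (nzcvgM ne nf).
Let nqn := nzcvgV (nzcvgX n nq).
Let nqn1 := nzcvg_div nq (nzcvgX n nq).

Let den2 k := @ccvg_epochs q_ q [:: (_, _); (_, _); (_, _)] k nq
  (conj (nx nb) (conj (nx nc) (conj (nx nd) I))).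
Let den3 k := @ccvg_epochs _ _ [:: (_, _); (_, _); (_, _)] k nq2
  (conj (ny ne) (conj (ny nf) (conj nn I))).
Let den4 k := @ccvg_epochs _ _ [:: (_, _); (_, _)] k nq2
  (conj nan (conj (nzcvg_div nan (nzcvgM nb nc)) I)).

Let om_args : all_nzcvg [:: (b_, b); (c_, c); (d_, d); (fun N => a_ N / e_ N, a / e);
  (fun N => a_ N / f_ N, a / f); (fun N => q_ N / q_ N ^+ n, q / q ^+ n);
  (fun N => q_ N ^- n, q ^- n)].
Proof.
split=> //; split=> //; split=> //; split; first exact: nzcvg_div na ne.
split; first exact: nzcvg_div na nf.
by split; [exact: nqn1 | split; [exact: nqn|]].
Qed.

Lemma trans_lhs_cvg : ccvg
  (fun N => trans_lhs p (q_ N) (a_ N) (b_ N) (c_ N) (d_ N) (e_ N) (f_ N) n)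
  (trans_lhs p q a b c d e f n).
Proof.
move: dens => /and5P [g1 g2 g3 _ _]; apply: ccvg_sum => k.
have kn : (k <= n)%N := leq_ord k.
have c1 := ccvg_div (ccvg_Eth (nzcvgM na (nzcvgX (3 * k) nq))) (ccvg_Eth na) g1.
have c2 := @ccvg_epochs _ _ [:: (_, _); (_, _); (_, _)] k nq2 (conj nb (conj nc (conj nd I))).
have c3 := @ccvg_epochs _ _ [:: (_, _); (_, _); (_, _)] k nq (conj ne (conj nf (conj nqn I))).
have c4 := ccvg_div c2 (@den2 k) (epochs_neq0_le kn g2).
have c5 := ccvg_div c3 (@den3 k) (epochs_neq0_le kn g3).
have c6 : ccvg (fun N => q_ N ^+ k) (q ^+ k) by case: nq => cq _ _; exact: ccvgX k cq.
exact: ccvgM (ccvgM (ccvgM c1 c4) c5) c6.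
Qed.

Lemma trans_rhs_cvg : ccvg
  (fun N => trans_rhs p (q_ N) (a_ N) (b_ N) (c_ N) (d_ N) (e_ N) (f_ N) n)
  (trans_rhs p q a b c d e f n).
Proof.
move: dens => /and5P [g1 g2 g3 g4 /and3P [g5 g6 _]].
have c1 := @ccvg_epochs _ _ [:: (_, _); (_, _)] n nq
  (conj (nzcvgM na nq) (conj (nx (nzcvgM nb nc)) I)).
have c2 := @ccvg_epochs _ _ [:: (_, _); (_, _)] n nq2
  (conj (nzcvg_div nan nb) (conj (nzcvg_div nan nc) I)).
have c3 := @ccvg_epochs _ _ [:: (_, _); (_, _)] n nq (conj (nx nb) (conj (nx nc) I)).
have g2' : epochs p q [:: a * q / b; a * q / c] n != 0.
  by move: g2; rewrite !epochs_neq0 => /and3P [h1 h2 _]; rewrite /= h1 h2.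
have c4 := ccvg_div (ccvgM c1 c2) (ccvgM c3 (@den4 n)) (mulf_neq0 g2' g4).
have c5 := ccvg_omega nq2 na1 om_args g5 g6.
exact: ccvgM c4 c5.
Qed.

Lemma trans_dens_near : \forall N \near \oo,
  all (fun z => z != 0) (trans_dens p (q_ N) (a_ N) (b_ N) (c_ N) (d_ N) (e_ N) (f_ N) n).
Proof.
move: dens => /and5P [g1 g2 g3 g4 /and3P [g5 g6 _]].
have h1 := ccvg_neq0 (ccvg_Eth na) g1.
have h2 := ccvg_neq0 (@den2 n) g2.
have h3 := ccvg_neq0 (@den3 n) g3.
have h4 := ccvg_neq0 (@den4 n) g4.
have h5 := ccvg_neq0 (ccvg_Eth na1) g5.
have nw u l (nu : nzcvg u l) := nzcvg_div (nzcvgM na1 nq2) nu.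
have c6 := @ccvg_epochs _ _ [:: (_, _); (_, _); (_, _); (_, _); (_, _); (_, _); (_, _); (_, _)] n./2 nq2
  (conj nq2 (conj (nw _ _ nb) (conj (nw _ _ nc) (conj (nw _ _ nd) (conj (nw _ _ (nzcvg_div na ne))
  (conj (nw _ _ (nzcvg_div na nf)) (conj (nw _ _ nqn1) (conj (nw _ _ nqn) I)))))))).
have h6 := ccvg_neq0 c6 g6.
refine (filterS _ (filterI h1 (filterI h2 (filterI h3 (filterI h4 (filterI h5 h6)))))).
move=> N [k1 [k2 [k3 [k4 [k5 k6]]]]].
apply/and5P; split; [exact k1 | exact k2 | exact k3 | exact k4 | apply/and3P].
by split; [exact k5 | exact k6 |].
Qed.

End Continuity.

(** Only q, a, c are perturbed; b and e stay, while d and f are solved from the balancing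
    conditions, which thus hold exactly along the sequence. Denominators are nonzero only
    eventually, hence [ccvg_unique_near]. *)
Lemma trans_main (q a b c d e f : C) n :
  q != 0 -> a != 0 -> b != 0 -> c != 0 -> d != 0 -> e != 0 -> f != 0 ->
  b * c * d = a ^+ 2 * q -> e * f = a * q ^+ n.+1 ->
  all (fun z => z != 0) (trans_dens p q a b c d e f n) ->
  trans_lhs p q a b c d e f n = trans_rhs p q a b c d e f n.
Proof.
move=> q0 a0 b0 c0 d0 e0 f0 hbcd hef dens.
have hN N : 0 < harmonic N :> R by rewrite invr_gt0.
have [x Hx] := choice (fun N => generic_approx hp q0 a0 c0 (hN N)).
pose q_ N := (x N).1.1; pose a_ N := (x N).1.2; pose c_ N := (x N).2.
have {}Hx N : [/\ q_ N != 0, a_ N != 0, c_ N != 0, [/\ normc (q_ N - q) <= normc q * harmonic N,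
    normc (a_ N - a) <= normc a * harmonic N & normc (c_ N - c) <= normc c * harmonic N] &
   [/\ forall i j : nat, i != j -> Eth p (q_ N ^+ i / q_ N ^+ j) != 0,
       ngen p (q_ N) (a_ N), ngen p (q_ N) (c_ N) & ngen p (q_ N) (c_ N / a_ N)]].
  by have := Hx N; rewrite /q_ /a_ /c_; case: (x N) => [[q' a'] c'].
have cvb (r : R) : (fun N => r * harmonic N) @ \oo --> (0 : R).
  rewrite -[0](mulr0 r); apply: (@cvgM R nat \oo _ (fun=> r)); first exact: cvg_cst.
  exact: cvg_harmonic.
have nq : nzcvg q_ q.
  split=> //; last by move=> N; case: (Hx N).
  by apply: (ccvg_squeeze _ (cvb (normc q))) => N; case: (Hx N) => _ _ _ [].
have na : nzcvg a_ a.
  split=> //; last by move=> N; case: (Hx N).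
  by apply: (ccvg_squeeze _ (cvb (normc a))) => N; case: (Hx N) => _ _ _ [].
have nc : nzcvg c_ c.
  split=> //; last by move=> N; case: (Hx N).
  by apply: (ccvg_squeeze _ (cvb (normc c))) => N; case: (Hx N) => _ _ _ [].
have nb := nzcvg_cst b0; have ne := nzcvg_cst e0.
have nd := nzcvg_div (nzcvgM (nzcvgX 2 na) nq) (nzcvgM nb nc).
have nf := nzcvg_div (nzcvgM na (nzcvgX n.+1 nq)) ne.
have dE : a ^+ 2 * q / (b * c) = d by rewrite -hbcd mulrAC divff ?mul1r // mulf_neq0.
have fE : a * q ^+ n.+1 / e = f by rewrite -hef mulrAC divff ?mul1r.
rewrite dE in nd; rewrite fE in nf.
apply: (ccvg_unique_near (trans_lhs_cvg nq na nb nc nd ne nf dens)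
  (trans_rhs_cvg nq na nb nc nd ne nf dens)).
refine (filterS _ (trans_dens_near nq na nb nc nd ne nf dens)) => N dN.
have [_ _ dN0] := nd; have [_ _ fN0] := nf.
case: (Hx N) => qN aN cN _ [gq ga gc gca].
apply: (trans_generic hp) => //.
  by rewrite mulrC divfK // mulf_neq0.
by rewrite mulrC divfK.
Qed.

End Limit.

(** The series on the right stops at [n./2]: for even n the parameter q^(-n), for odd n the
    parameter q^(1-n), is the base q^2 to the power [- n./2]. *)
Theorem theorem4p7 (R : realType) (p q a b c d e f : R[i]) (n : nat)
  (hp : `|p| < 1) (hq : q != 0)
  (ha : a != 0) (hb : b != 0) (hc : c != 0) (hd : d != 0) (he : e != 0) (hf : f != 0)
  (hbcd : b * c * d = a ^+ 2 * q)
  (hef : e * f = a * q ^+ n.+1)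
  (* genericity: no denominator vanishes *)
  (g1 : Eth p a != 0)
  (g2 : epochs p q [:: a * q / b; a * q / c; a * q / d] n != 0)
  (g3 : epochs p (q ^+ 2) [:: a * q ^+ 2 / e; a * q ^+ 2 / f; a * q ^+ n.+2] n != 0)
  (g4 : epochs p (q ^+ 2) [:: a * q / q ^+ n; a * q / q ^+ n / (b * c)] n != 0)
  (g5 : Eth p (a ^+ 2 / (e * f)) != 0)
  (g6 : epochs p (q ^+ 2)
          (q ^+ 2 :: [seq a ^+ 2 / (e * f) * q ^+ 2 / ai
                     | ai <- [:: b; c; d; a / e; a / f; q / q ^+ n; q ^- n]]) n./2 != 0) :
  \sum_(k < n.+1)
     (Eth p (a * q ^+ (3 * k)) / Eth p a) *
     (epochs p (q ^+ 2) [:: b; c; d] k / epochs p q [:: a * q / b; a * q / c; a * q / d] k) *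
     (epochs p q [:: e; f; q ^- n] k /
        epochs p (q ^+ 2) [:: a * q ^+ 2 / e; a * q ^+ 2 / f; a * q ^+ n.+2] k) *
     q ^+ k
  = (epochs p q [:: a * q; a * q / (b * c)] n *
       epochs p (q ^+ 2) [:: a * q / q ^+ n / b; a * q / q ^+ n / c] n) /
    (epochs p q [:: a * q / b; a * q / c] n *
       epochs p (q ^+ 2) [:: a * q / q ^+ n; a * q / q ^+ n / (b * c)] n) *
    omega p (q ^+ 2) (a ^+ 2 / (e * f))
      [:: b; c; d; a / e; a / f; q / q ^+ n; q ^- n] n./2.
Proof.
apply: trans_main => //; first by move: hp; rewrite normcP ltcE /= => /andP [].
apply/and5P; split; [exact g1 | exact g2 | exact g3 | exact g4 | apply/and3P].
by split; [exact g5 | exact g6 |].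
Qed.
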